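(* Consider the Gaussian doubly dirty multiple access channel with partial (estimated) side information at the transmitters, with power constraints $P_1,P_2>0$, noise variance $N>0$ and side-information estimation distortions $E_1,E_2\ge 0$, as defined in the context. Suppose $P_1\neq P_2$ and that the channel is imbalanced, i.e. $$E_1+E_2+N\le \sqrt{P_1P_2}-\min(P_1,P_2).$$ Then every pair of nonnegative rates $(R_1,R_2)$ satisfying $$R_1+R_2\le \frac12\log_2\left(1+\frac{\min(P_1,P_2)}{E_1+E_2+N}\right)$$ is achievable.
   Context: Channel model (Gaussian doubly dirty MAC with partial side information at the transmitters). Over $n$ uses the real-valued channel output is $$\mathbf Y=\mathbf X_1+\mathbf X_2+\mathbf S_1+\mathbf S_2+\mathbf Z,$$ where all quantities are vectors in $\mathbb R^n$; $\mathbf Z$ has i.i.d. $\mathcal N(0,N)$ components; $\mathbf X_i$ is the input of user $i$, subject to the average power constraint $\frac1n\mathbb E\|\mathbf X_i\|^2\le P_i$; and $\mathbf S_i$ is the interference (side information) associated with user $i$, of arbitrary strength. Encoder $i$ does not know $\mathbf S_i$ exactly; it knows, non-causally (the entire block before transmission), only an estimated version $\tilde{\mathbf S}_i$. The pairs of components $(S_i,\tilde S_i)$ are i.i.d. over time and satisfy $\mathbb E[(S_i-\tilde S_i)^2]=E_i$, $i=1,2$. The pairs $(\mathbf S_1,\tilde{\mathbf S}_1)$, $(\mathbf S_2,\tilde{\mathbf S}_2)$, the noise $\mathbf Z$ and the messages are mutually independent. The decoder knows neither $\mathbf S_i$ nor $\tilde{\mathbf S}_i$. User $i$ has a message $W_i$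 uniform on a set of size $\lceil 2^{nR_i}\rceil$ ($W_1,W_2$ independent). Encoder $i$ maps $(W_i,\tilde{\mathbf S}_i)$ to $\mathbf X_i$, and the decoder estimates $(W_1,W_2)$ from $\mathbf Y$. Encoders may use random dither signals, independent of everything else, where the dither of encoder $i$ is known to encoder $i$ and to the decoder. A rate pair $(R_1,R_2)$ is achievable if it belongs to the closure of the set of rate pairs for which there is a sequence of such codes with error probability tending to $0$ as $n\to\infty$. *)

(* Defs.v *)
From HB Require Import structures.
From mathcomp Require Import all_boot all_order all_algebra.
From mathcomp Require Import all_classical all_reals all_analysis.

Set Implicit Arguments.
Unset Strict Implicit.
Unset Printing Implicit Defensive.

Import Order.TTheory GRing.Theory Num.Theory.
Import numFieldNormedType.Exports.

Local Open Scope classical_set_scope.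
Local Open Scope ring_scope.

Definition log2 (R : realType) (x : R) : R := ln x / ln 2.

Section vectors.
Context {R : realType} {n : nat}.
Implicit Types x y : n.-tuple R.

Definition vadd x y : n.-tuple R := [tuple tnth x i + tnth y i | i < n].

Definition sqnorm x : R := \sum_(i < n) tnth x i ^+ 2.

End vectors.

Section iid.
Context {d : measure_display} {T : measurableType d} {R : realType}.

Definition consT n (x : T * n.-tuple T) : n.+1.-tuple T := [tuple of x.1 :: x.2].

Lemma measurable_consT n : measurable_fun [set: T * n.-tuple T] (@consT n).
Proof. by apply: measurable_cons. Qed.

HB.instance Definition _ n :=
  isMeasurableFun.Build _ _ _ _ (@consT n) (@measurable_consT n).

(* The n-fold product Q x ... x Q: the law of n i.i.d. samples of Q. *)
Fixpoint iid_law (Q : probability T R) (n : nat) : probability (n.-tuple T) R :=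
  match n with
  | 0 => dirac [tuple]
  | m.+1 => distribution (Q \x iid_law Q m)%E (@consT m)
  end.

(* On boxes, iid_law is the product of the marginals; boxes generate the
   sigma-algebra of n.-tuple T, so this identity characterizes it. *)
Lemma iid_law_box (Q : probability T R) n (A : 'I_n -> set T) :
  (forall i, measurable (A i)) ->
  iid_law Q n [set x | forall i, A i (tnth x i)] = (\prod_(i < n) Q (A i))%E.
Proof.
elim: n A => [|n IHn] A mA /=.
  rewrite big_ord0 /dirac indicE mem_set//=; by case.
pose B := [set x : n.-tuple T | forall i, A (lift ord0 i) (tnth x i)].
have mB : measurable B.
  have -> : B = \bigcap_(i in [set: 'I_n]) ((@tnth n T)^~ i @^-1` A (lift ord0 i)).
    by apply/seteqP; split => x /= h i; [move=> _; exact: h|exact: (h i I)].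
  apply: fin_bigcap_measurable => // i _.
  by rewrite -[_ @^-1` _]setTI; exact: measurable_tnth.
rewrite big_ord_recl -IHn// -product_measure1E//.
rewrite /distribution /pushforward/=; congr ((_ \x _)%E _).
apply/seteqP; split => -[x y] /=.
  by move=> h; split=> [|i]; [have := h ord0|have := h (lift ord0 i); rewrite tnthS].
move=> [h0 h] i; have [j ->|->//] := unliftP ord0 i.
by rewrite tnthS; exact: h.
Qed.

End iid.

Section noise.
Context {R : realType}.
Variable N : R.

(* normal_prob takes the standard deviation, not the variance, and is a measure
   on measurableTypeR R; it is transported to the canonical measurable structure
   of R, which has the same measurable sets under another display. *)
Definition noise_law : set R -> \bar R := normal_prob 0 (Num.sqrt N).

Let noise0 : noise_law set0 = 0%E.
Proof. exact: (@measure0 _ _ _ (normal_prob 0 (Num.sqrt N))). Qed.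

Let noise_ge0 A : (0 <= noise_law A)%E.
Proof. exact: (@measure_ge0 _ _ _ (normal_prob 0 (Num.sqrt N))). Qed.

Let noise_sigma_additive : semi_sigma_additive noise_law.
Proof.
exact: (@measure_semi_sigma_additive _ _ _ (normal_prob 0 (Num.sqrt N))).
Qed.

HB.instance Definition _ := isMeasure.Build _ _ _ noise_law
  noise0 noise_ge0 noise_sigma_additive.

Let noise_setT : noise_law setT = 1%E.
Proof. exact: (@probability_setT _ _ _ (normal_prob 0 (Num.sqrt N))). Qed.

HB.instance Definition _ :=
  Measure_isProbability.Build _ _ _ noise_law noise_setT.

End noise.

(* Block code of length n with M1 and M2 messages.  The dither of user i takes
   values in an arbitrary measurable space dither_i, with an arbitrary law. *)
Record code (R : realType) (n M1 M2 : nat) := Code {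
  ddisp1 : measure_display;
  ddisp2 : measure_display;
  dither1 : measurableType ddisp1;
  dither2 : measurableType ddisp2;
  dlaw1 : probability dither1 R;
  dlaw2 : probability dither2 R;
  enc1 : 'I_M1 -> n.-tuple R * dither1 -> n.-tuple R;
  enc2 : 'I_M2 -> n.-tuple R * dither2 -> n.-tuple R;
  dec : n.-tuple R * dither1 * dither2 -> 'I_M1 * 'I_M2;
  measurable_enc1 : forall w, measurable_fun setT (enc1 w);
  measurable_enc2 : forall w, measurable_fun setT (enc2 w);
  measurable_dec : forall m, measurable (dec @^-1` [set m])
}.

Section dirty_mac.
Context {R : realType}.
(* P1, P2: powers; N: noise variance; Qi: joint law of one pair
   (S_i, estimate of S_i). *)
Variables (P1 P2 N : R) (Q1 Q2 : probability (R * R)%type R).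

Section fixed_code.
Context {n M1 M2 : nat} (c : code R n M1 M2).

(* Outcomes: the n pairs (S_1, estimate), the n pairs (S_2, estimate), the
   noise, and the two dithers.  The uniform messages, independent of all these,
   are averaged over explicitly in power1, power2 and error_prob below. *)
Definition outcome : Type :=
  (n.-tuple (R * R) * n.-tuple (R * R) * n.-tuple R * dither1 c * dither2 c)%type.

Definition outcome_law : set outcome -> \bar R :=
  (iid_law Q1 n \x iid_law Q2 n \x iid_law (noise_law N) n
     \x dlaw1 c \x dlaw2 c)%E.

Implicit Types o : outcome.

Definition side1 o : n.-tuple R := map_tuple fst o.1.1.1.1.
Definition side1_est o : n.-tuple R := map_tuple snd o.1.1.1.1.
Definition side2 o : n.-tuple R := map_tuple fst o.1.1.1.2.
Definition side2_est o : n.-tuple R := map_tuple snd o.1.1.1.2.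
Definition noise o : n.-tuple R := o.1.1.2.
Definition dith1 o : dither1 c := o.1.2.
Definition dith2 o : dither2 c := o.2.

Definition input1 (w : 'I_M1) o : n.-tuple R := enc1 w (side1_est o, dith1 o).
Definition input2 (w : 'I_M2) o : n.-tuple R := enc2 w (side2_est o, dith2 o).

Definition output (w : 'I_M1 * 'I_M2) o : n.-tuple R :=
  vadd (vadd (vadd (vadd (input1 w.1 o) (input2 w.2 o)) (side1 o)) (side2 o))
    (noise o).

Definition decoded (w : 'I_M1 * 'I_M2) o : 'I_M1 * 'I_M2 :=
  dec (output w o, dith1 o, dith2 o).

Definition power1 : \bar R :=
  ((n%:R^-1)%:E * ((M1%:R^-1)%:E *
    \sum_(w : 'I_M1) \int[outcome_law]_o (sqnorm (input1 w o))%:E))%E.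
Definition power2 : \bar R :=
  ((n%:R^-1)%:E * ((M2%:R^-1)%:E *
    \sum_(w : 'I_M2) \int[outcome_law]_o (sqnorm (input2 w o))%:E))%E.

Definition error_prob : \bar R :=
  (((M1 * M2)%:R^-1)%:E *
    \sum_(w : 'I_M1 * 'I_M2) outcome_law [set o | decoded w o <> w])%E.

End fixed_code.

Definition num_messages (n : nat) (r : R) : nat := `|Num.ceil (2 `^ (n%:R * r))|%N.

Definition attained_rates : set (R * R) := [set r | [/\ 0 <= r.1, 0 <= r.2 &
  exists c : forall n, code R n (num_messages n r.1) (num_messages n r.2),
    (forall n, (0 < n)%N ->
       (power1 (c n) <= P1%:E)%E /\ (power2 (c n) <= P2%:E)%E) /\
    error_prob (c n) @[n --> \oo] --> 0%E]].

Definition achievable (r : R * R) : Prop := closure attained_rates r.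

End dirty_mac.

(* Main.v *)
(* Both users share one mod-p lattice. Its cosets are F_p^n modulo a random
   k-dimensional linear code spanned by G, and rep(h) denotes a representative
   of h + <G> of energy at most n P / a^2, where a is the grid step and
   P = min(P1, P2); such a representative exists for almost all h because
   p^k |ball| exceeds p^n by a polynomial factor.  User i sends
   a beta_i rep(v_i(w_i) - floor(alpha est_i / a) - d_i), with d_i a uniform
   dither, alpha = P / (P + K) and K = E1 + E2 + N.  The weaker user takes
   beta = 1, the stronger one beta = 1 / alpha; the latter is affordable exactly
   because the channel is imbalanced.  Modulo the lattice, the decoder sees
   v_1(w_1) + v_2(w_2) plus a noise of energy per symbol alpha K: the stronger
   user leaves no self noise, the weaker one (1 - alpha)^2 P, and the channel
   noise and estimation errors alpha^2 K.  Random codebooks are decodable as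
   long as 2^(n (R1 + R2)) is smaller than the ratio of the number of grid
   points in balls of energies P and alpha K, and comparing balls by an explicit
   injection shows that this ratio is about (P / (alpha K))^(n/2). *)
From HB Require Import structures.
Require Import Defs.
From mathcomp Require Import all_boot all_order all_algebra.
From mathcomp Require Import all_classical all_reals all_analysis.
From mathcomp Require Import measurable_realfun normal_distribution.
From mathcomp Require Import zify ring lra.
Import Order.TTheory GRing.Theory Num.Theory.
Import numFieldNormedType.Exports HBNNSimple.
Local Open Scope classical_set_scope.
Local Open Scope ring_scope.

Set Implicit Arguments.
Unset Strict Implicit.
Unset Printing Implicit Defensive.

(** * Random linear codes over a finite field *)

(** Both interferences reach the decoder with coefficient 1, so one scaling [alpha] has to serve
    both users, and the self noise of user i is [alpha * beta_i - 1] times its representative. With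
    [beta_i = 1] for both there would be two such terms. Taking [beta = 1 / alpha] removes one of
    them at the power [(P + K) ^+ 2 / P], so the imbalance is needed in the form
    [(P + K) ^+ 2 <= P1 * P2]. The value of [alpha] minimizes
    [(1 - alpha) ^+ 2 * P + alpha ^+ 2 * K]; the minimum is [P * K / (P + K)], and [P] divided by it
    is [1 + P / K]. The estimation errors have an arbitrary, possibly biased law of which only the
    second moment is known. Hence the decoder merely tests membership in a ball, and the noise
    enters through its norm alone, controlled by a weak law. Modulo p, dithers, codewords and
    effective noise take finitely many values, so the averages over lattices, codebooks and residues
    are finite counts. The grid step and all slacks are fixed before n; only p, k, [G] and the
    codebooks vary with n. *)

Lemma sum_nat_pred (T : finType) (P : pred T) :
  (\sum_(x : T) P x = #|[pred x | P x]|)%N.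
Proof.
rewrite -sum1_card [RHS]big_mkcond; apply: eq_bigr => x _.
by rewrite unfold_in /=; case: (P x).
Qed.

(* The bijections sh y translate L, hence L is equidistributed over W. *)
Lemma card_shift_preim (V W : finType) (L : V -> W) (add : W -> W -> W)
    (sh : W -> V -> V) (B : pred W) :
  (forall x, injective (add x)) -> (forall y, injective (sh y)) ->
  (forall y v, L (sh y v) = add (L v) y) ->
  (#|[pred v | B (L v)]| * #|W| = #|V| * #|B|)%N.
Proof.
move=> addI shI Lsh.
have e1 (y : W) : (\sum_(v : V) B (add (L v) y) = #|[pred v | B (L v)]|)%N.
  rewrite -sum1_card [RHS]big_mkcond [RHS](reindex_inj (shI y)) /=.
  by apply: eq_bigr => v _; rewrite unfold_in /= Lsh; case: (B _).
have e2 (v : V) : (\sum_(y : W) B (add (L v) y) = #|B|)%N.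
  rewrite -sum1_card [RHS]big_mkcond [RHS](reindex_inj (addI (L v))) /=.
  by apply: eq_bigr => y _; rewrite unfold_in; case: (B _).
transitivity (\sum_(y : W) \sum_(v : V) B (add (L v) y))%N.
  by rewrite (eq_bigr _ (fun y _ => e1 y)) sum_nat_const mulnC.
by rewrite exchange_big /= (eq_bigr _ (fun v _ => e2 v)) sum_nat_const.
Qed.

Section random_lattice.
Variables (F : finFieldType) (k n : nat).
Implicit Types (G : 'M[F]_(k, n)) (h : 'rV[F]_n) (u : 'rV[F]_k).

Lemma row_right_inverse u : u != 0 -> exists M : 'M[F]_(k, 1), u *m M = 1%:M.
Proof.
move=> /rV0Pn[j uj0].
exists (\col_i (if i == j then (u 0 j)^-1 else 0)).
apply/matrixP => a b; rewrite !ord1 !mxE eqxx (bigD1 j)//= !mxE eqxx divff//.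
by rewrite big1 ?addr0// => i /negPf ij; rewrite !mxE ij mulr0.
Qed.

Lemma card_one_point (B : pred 'rV[F]_n) u :
  (#|[pred p : 'M[F]_(k, n) * 'rV[F]_n | B (p.2 + u *m p.1)%R]| * #|{: 'rV[F]_n}| =
   #|{: 'M[F]_(k, n) * 'rV[F]_n}| * #|B|)%N.
Proof.
apply: (@card_shift_preim _ 'rV[F]_n
  (fun p : 'M[F]_(k, n) * 'rV[F]_n => p.2 + u *m p.1) +%R
  (fun y p => (p.1, p.2 + y))).
- exact: addrI.
- by move=> y [a b] [c d] [-> /addIr ->].
- by move=> y [a b] /=; rewrite addrAC.
Qed.

(** If [(u - u') *m M = 1], adding [M *m (y.1 - y.2)] to [G] moves the difference of the two points
    by [y.1 - y.2], and a translation of [h] then puts the first point in place. So the pair of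
    points can be shifted by an arbitrary pair of vectors. *)
Lemma card_two_points (B : pred 'rV[F]_n) u u' : u != u' ->
  (#|[pred p : 'M[F]_(k, n) * 'rV[F]_n | B (p.2 + u *m p.1)%R && B (p.2 + u' *m p.1)%R]|
     * (#|{: 'rV[F]_n}| * #|{: 'rV[F]_n}|) =
   #|{: 'M[F]_(k, n) * 'rV[F]_n}| * (#|B| * #|B|))%N.
Proof.
rewrite -subr_eq0 => /row_right_inverse[M uM].
pose L (p : 'M[F]_(k, n) * 'rV[F]_n) : ('rV[F]_n * 'rV[F]_n)%type :=
  (p.2 + u *m p.1, p.2 + u' *m p.1).
pose C : pred ('rV[F]_n * 'rV[F]_n)%type := [pred q | B q.1 && B q.2].
have := @card_shift_preim _ ('rV[F]_n * 'rV[F]_n)%type L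
  (fun x y => (x.1 + y.1, x.2 + y.2))
  (fun y p => (p.1 + M *m (y.1 - y.2),
               p.2 + y.1 - u *m (M *m (y.1 - y.2)))) C.
rewrite !card_prod => -> //.
- congr (_ * _)%N; rewrite -cardX; apply: eq_card => -[a b].
  by rewrite !inE.
- by move=> x [a b] [c d] [] /addrI -> /addrI ->.
- by move=> y [a b] [c d] [] /addIr -> /addIr /addIr ->.
- move=> y [a b]; rewrite /L /=.
  have Mu (d : 'rV[F]_n) : u' *m (M *m d) = u *m (M *m d) - d.
    by apply/eqP; rewrite eq_sym subr_eq addrC -subr_eq -mulmxBl mulmxA uM mul1mx.
  case: y => c d /=; have [e ->] : exists e, d = c - e by exists (c - d); rewrite subKr.
  rewrite subKr !mulmxDr Mu; set X := u *m (M *m _).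
  move: X (u *m a) (u' *m a) => X p q.
  by congr pair; apply/matrixP => i j; rewrite !mxE; ring.
Qed.

(* For uniform G and h the points h + u G are pairwise independent, and
   Chebyshev's inequality applies to the number of those lying in B. *)
Lemma exists_good_lattice (B : pred 'rV[F]_n) :
  exists G, (#|[pred h | [forall u, ~~ B (h + u *m G)%R]]| * (#|{: 'rV[F]_k}| * #|B|) <=
             #|{: 'rV[F]_n}| * #|{: 'rV[F]_n}|)%N.
Proof.
set N := #|{: 'rV[F]_n}|; set K := #|{: 'rV[F]_k}|; set b := #|B|.
pose gs := #|{: 'M[F]_(k, n)}|.
pose X (p : 'M[F]_(k, n) * 'rV[F]_n) : nat := (\sum_u B (p.2 + u *m p.1)%R)%N.
have N0 : (0 < N)%N by apply/card_gt0P; exists 0.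
have cGN : #|{: 'M[F]_(k, n) * 'rV[F]_n}| = (gs * N)%N by rewrite card_prod.
have EX : (\sum_p X p = gs * K * b)%N.
  rewrite exchange_big /=.
  have e u : (\sum_(p : 'M[F]_(k, n) * 'rV[F]_n) B (p.2 + u *m p.1)%R = gs * b)%N.
    apply/eqP; rewrite -(eqn_pmul2r N0) -mulnA (mulnC b) mulnA -cGN -(card_one_point B u).
    by rewrite sum_nat_pred.
  by rewrite (eq_bigr _ (fun u _ => e u)) sum_nat_const -/K mulnCA mulnA.
have EX2 : (N * \sum_p X p ^ 2 <= gs * K * b * N + gs * K * K * b * b)%N.
  have sq p : (X p ^ 2 = \sum_u \sum_u' (B (p.2 + u *m p.1)%R && B (p.2 + u' *m p.1)%R))%N.
    rewrite -mulnn {1}/X big_distrl; apply: eq_bigr => u _.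
    by rewrite /X big_distrr; apply: eq_bigr => u' _; rewrite -mulnb.
  rewrite (eq_bigr _ (fun p _ => sq p)) exchange_big /=.
  under eq_bigr do rewrite exchange_big /=.
  rewrite big_distrr /=.
  apply: (@leq_trans (\sum_(u : 'rV[F]_k) (gs * b * N + gs * K * b * b)))%N; last first.
    rewrite sum_nat_const -/K; lia.
  apply: leq_sum => u _; rewrite (bigD1 u)//= mulnDr; apply: leq_add.
    rewrite -mulnA (mulnC b) mulnA -cGN -(card_one_point B u) mulnC leq_mul2r.
    apply/orP; right; rewrite -sum_nat_pred.
    by apply: leq_sum => p _; rewrite andbb.
  rewrite big_distrr /=.
  apply: (@leq_trans (\sum_(u' : 'rV[F]_k) (gs * b * b)))%N; last first.
    rewrite sum_nat_const -/K; lia.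
  rewrite big_mkcond; apply: leq_sum => u' _; case: ifP => // uu'.
  have uu : u != u' by rewrite eq_sym.
  rewrite -(leq_pmul2r N0).
  have := card_two_points B uu; rewrite cGN -/N -/b => H.
  apply: (@leq_trans (gs * N * (b * b)))%N; last lia.
  rewrite -H -mulnA mulnCA leq_mul2r; apply/orP; right.
  by rewrite -sum_nat_pred.
pose z G := #|[pred h | [forall u, ~~ B (h + u *m G)%R]]|.
(* Chebyshev's inequality without division or subtraction: [N * X] has mean [K * b], and the
   indicator of [X = 0] times [(K * b) ^ 2] is at most [(N * X - K * b) ^ 2]. The cross term is kept
   on the left and the inequality is summed over all [p]. *)
have zX : ((\sum_G z G) * (K * b) ^ 2 + 2 * (N * K * b) * (gs * K * b) <=
   N ^ 2 * (\sum_p X p ^ 2) + (K * b)^2 * (gs * N))%N.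
  have -> : (\sum_G z G = \sum_p (X p == 0))%N.
    rewrite -(pair_bigA _ (fun a b => (X (a, b) == 0) : nat)%N) /=.
    apply: eq_bigr => G _; rewrite /z -sum_nat_pred.
    apply: eq_bigr => h _; rewrite /X sum_nat_eq0.
    by congr nat_of_bool; apply: eq_forallb => u /=; case: (B _).
  have Hp p : ((X p == 0) * (K * b) ^ 2 + 2 * (N * K * b) * X p <=
      N ^ 2 * X p ^ 2 + (K * b) ^ 2 * 1)%N.
    have [->|_] := eqVneq (X p) 0%N; first by lia.
    rewrite mul0n add0n muln1 -expnMn; apply: leq_trans (nat_Cauchy _ _).
    by rewrite leq_eqVlt; apply/orP; left; apply/eqP; ring.
  have := @leq_sum _ (index_enum _) xpredT _ _ (fun p _ => Hp p).
  by rewrite !big_split -!big_distrr -!big_distrl /= sum1_card cGN EX.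
have [->|b0] := posnP b; first by exists 0; rewrite !muln0.
have K0 : (0 < K)%N by apply/card_gt0P; exists 0.
have key : ((\sum_G z G) * (K * b) <= gs * (N * N))%N.
  rewrite -(@leq_pmul2r (K * b)) ?muln_gt0 ?K0//.
  have := leq_mul (leqnn N) EX2; move: zX; rewrite -!mulnn.
  move: (\sum_G z G)%N (\sum_p X p ^ 2)%N => S S2; lia.
(* Pigeonhole: some [G] does no worse than the average bounded by [key]. *)
case: (boolP [exists G, (z G * (K * b) <= N * N)%N]) => [/existsP//|].
rewrite negb_exists => /forallP H; exfalso.
have := @leq_sum _ (index_enum _) xpredT (fun=> (N * N).+1) (fun G => z G * (K * b))%N.
have gs0 : (0 < gs)%N by apply/card_gt0P; exists 0.
rewrite sum_nat_const -/gs -big_distrl /= => /(_ _)/wrap[G _|].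
  by rewrite ltnNge.
set S := (\sum_i z i)%N in key *. lia.
Qed.
End random_lattice.

(** * Balls of integer vectors modulo a prime *)

Section centered_lift.
Variable p : nat.
Hypothesis pp : prime p.

Definition centered_lift (g : 'F_p) : int := if (2 * g < p)%N then g%:Z else g%:Z - p%:Z.

Lemma centered_liftK g : (centered_lift g)%:~R = g.
Proof.
have gE : g%:R = g :> 'F_p by exact: natr_Zp.
rewrite /centered_lift; case: ifP => _; first by rewrite -pmulrn gE.
by rewrite intrB -!pmulrn gE pchar_Fp_0// subr0.
Qed.

Lemma centered_lift_bound g : (2 * `|centered_lift g| <= p)%N.
Proof.
have : (g < p)%N by rewrite -[ltnRHS](Fp_cast pp) ltn_ord.
by rewrite /centered_lift; case: ifP => ? ?; lia.
Qed.

Lemma centered_lift_congr (z : int) : exists q : int, z = centered_lift z%:~R + q * p%:Z.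
Proof.
have /dvdzP[q qE] : (p %| z - centered_lift z%:~R)%Z.
  by rewrite (dvdz_pcharf (pchar_Fp pp)) intrB centered_liftK subrr.
by exists q; rewrite -qE addrC subrK.
Qed.

Lemma centered_lift_small (z : int) : (2 * `|z| < p)%N -> centered_lift z%:~R = z.
Proof.
have [q zE] := centered_lift_congr z; have := centered_lift_bound z%:~R => cb zb.
have q0 : q = 0 by nia.
by rewrite {2}zE q0 mul0r addr0.
Qed.

(** Either [z] is its own centered lift, or [|z|] is at least [p / 2], which bounds every centered
    lift. Hence reduction modulo [p] never increases an energy, and a short integer vector stays in
    its ball even if it wraps around. *)
Lemma centered_lift_min (z : int) : (`|centered_lift z%:~R| <= `|z|)%N.
Proof.
have [/centered_lift_small -> //|] := ltnP (2 * `|z|) p.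
have := centered_lift_bound z%:~R; lia.
Qed.

Section ball.
Context {R : realFieldType}.

Definition lift_coord n (g : 'rV['F_p]_n) (i : 'I_n) : R := (centered_lift (g 0 i))%:~R.

Definition grid_ball n (r2 : R) : pred 'rV['F_p]_n :=
  fun g => \sum_i lift_coord g i ^+ 2 <= n%:R * r2.

Lemma sqr_add_le (e a b : R) : 0 < e ->
  (a + b) ^+ 2 <= (1 + e) * a ^+ 2 + (1 + e^-1) * b ^+ 2.
Proof.
move=> e0; have : 0 <= e^-1 * (e * a - b) ^+ 2.
  by rewrite mulr_ge0 ?sqr_ge0// invr_ge0 ltW.
have -> : e^-1 * (e * a - b) ^+ 2 = e * a ^+ 2 + e^-1 * b ^+ 2 - a * b *+ 2.
  by field; rewrite gt_eqF.
by lra.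
Qed.

(** The weight [e] keeps the main factor close to 1. A rounding error of at most [c] per coordinate
    then costs an additive constant, negligible once energies are large when measured in grid
    steps. *)
Lemma sum_sqr_add_le n (e r2 c : R) (a b : 'I_n -> R) : 0 < e ->
  (forall i, `|b i - a i| <= c) -> \sum_i a i ^+ 2 <= n%:R * r2 ->
  \sum_i b i ^+ 2 <= n%:R * ((1 + e) * r2 + (1 + e^-1) * c ^+ 2).
Proof.
move=> e0 hd ha.
apply: (@le_trans _ _ (\sum_i ((1 + e) * a i ^+ 2 + (1 + e^-1) * c ^+ 2))).
  apply: ler_sum => i _; rewrite -[b i](subrK (a i)) addrC.
  apply: (le_trans (sqr_add_le _ _ e0)); rewrite lerD2l ler_wpM2l//.
    by rewrite addr_ge0// invr_ge0 ltW.
  by rewrite -[leLHS]real_normK ?num_real// lerXn2r ?nnegrE// (le_trans _ (hd i)).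
rewrite big_split -mulr_sumr /= sumr_const card_ord -[X in _ + X]mulr_natl mulrDr.
by rewrite lerD2r mulrCA ler_wpM2l// addr_ge0// ltW.
Qed.

Lemma grid_ball_cast n (r2 : R) (z : 'I_n -> int) :
  \sum_i ((z i)%:~R : R) ^+ 2 <= n%:R * r2 -> grid_ball r2 (\row_i (z i)%:~R).
Proof.
apply: le_trans; apply: ler_sum => i _; rewrite /lift_coord mxE -!rmorphXn/= ler_int.
have := centered_lift_min (z i); move: (centered_lift _) => c; nia.
Qed.

Lemma sum_sqr_ge n (a : 'I_n -> R) i : a i ^+ 2 <= \sum_j a j ^+ 2.
Proof. by rewrite (bigD1 i)//= lerDl sumr_ge0// => j _; rewrite sqr_ge0. Qed.

(* The pair (y, j) is recovered from the quotient x and the remainder of m y + j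
   by k, and x is within m / k + 1 of (m / k) y; the last hypothesis keeps x from
   wrapping around modulo p. *)
Lemma card_grid_ball_ratio n (m k : nat) (e t2 b2 : R) : (0 < m)%N -> (0 < k)%N ->
  0 < e ->
  (1 + e) * ((m%:R / k%:R) ^+ 2 * t2) + (1 + e^-1) * (m%:R / k%:R + 1) ^+ 2 <= b2 ->
  4 * (n%:R * b2) < p%:R ^+ 2 ->
  (#|[pred g : 'rV['F_p]_n | grid_ball t2 g]| * m ^ n <=
   #|[pred g : 'rV['F_p]_n | grid_ball b2 g]| * k ^ n)%N.
Proof.
case: m => // m _; case: k => // k _ e0 hb hp.
set lam := m.+1%:R / k.+1%:R in hb.
pose x (q : 'rV['F_p]_n * {ffun 'I_n -> 'I_m.+1}) i : int :=
  ((m.+1%:Z * centered_lift (q.1 0%R i) + (q.2 i)%:Z) %/ k.+1)%Z.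
pose y (q : 'rV['F_p]_n * {ffun 'I_n -> 'I_m.+1}) i : int :=
  ((m.+1%:Z * centered_lift (q.1 0%R i) + (q.2 i)%:Z) %% k.+1)%Z.
pose f q : 'rV['F_p]_n * {ffun 'I_n -> 'I_k.+1} :=
  (\row_i (x q i)%:~R, [ffun i => inord `|y q i|%N]).
have xb q : grid_ball t2 q.1 -> \sum_i ((x q i)%:~R : R) ^+ 2 <= n%:R * b2.
  move=> qb; apply: (@le_trans _ _ (n%:R * ((1 + e) * (lam ^+ 2 * t2) + (1 + e^-1) * (lam + 1) ^+ 2))).
    apply: (@sum_sqr_add_le _ _ _ _ (fun i => lam * lift_coord q.1 i)) => //.
      move=> i; have k0 : 0 < k.+1%:R :> R by rewrite ltr0n.
      have -> : (x q i)%:~R - lam * lift_coord q.1 i = ((q.2 i)%:R - (y q i)%:~R) / k.+1%:R.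
        have := divz_eq (m.+1%:Z * centered_lift (q.1 0 i) + (q.2 i)%:Z) k.+1.
        rewrite -/(x q i) -/(y q i); move: (x q i) (y q i) => X Y.
        move=> /(congr1 (fun z : int => z%:~R : R)).
        rewrite !intrD !intrM -!pmulrn /lift_coord /lam => H.
        have -> : Y%:~R = m.+1%:R * (centered_lift (q.1 0 i))%:~R + (q.2 i)%:R - X%:~R * k.+1%:R :> R.
          by rewrite H addrAC subrr add0r.
        by field; rewrite -natr1 addrC in k0; rewrite gt_eqF.
      have y0 : 0 <= y q i by rewrite modz_ge0.
      have yk : y q i < k.+1 by apply: ltz_pmod.
      have qm := ltn_ord (q.2 i).
      rewrite normrM [`|_^-1|]ger0_norm ?invr_ge0// ler_pdivrMr// mulrDl mul1r divfK ?gt_eqF//.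
      have : `|(q.2 i)%:Z - y q i| <= (m.+1 + k.+1)%N by move: y0 yk; lia.
      move: (y q i) => Y; rewrite -(ler_int R) intr_norm intrB -!pmulrn natrD.
      by [].
    under eq_bigr do rewrite exprMn.
    by rewrite -mulr_sumr mulrCA ler_wpM2l ?sqr_ge0.
  by rewrite ler_wpM2l.
have cx q i : grid_ball t2 q.1 -> centered_lift (x q i)%:~R = x q i.
  move=> /xb qb; apply: centered_lift_small.
  have := le_trans (sum_sqr_ge (fun i => (x q i)%:~R) i) qb => /(ler_wpM2l (ler0n R 4)) H.
  have := le_lt_trans H hp; move: (x q i) => X XH.
  have : 4%:Z * X ^+ 2 < p%:Z ^+ 2 by rewrite -(ltr_int R) intrM !rmorphXn /=.
  by nia.
pose A := [pred q : 'rV['F_p]_n * {ffun 'I_n -> 'I_m.+1} | grid_ball t2 q.1].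
pose B := [pred q : 'rV['F_p]_n * {ffun 'I_n -> 'I_k.+1} | grid_ball b2 q.1].
have fI : {in A &, injective f}.
  move=> q q' qA q'A [] /rowP e1 /ffunP e2.
  have xx i : x q i = x q' i.
    by rewrite -(cx q i qA) -(cx q' i q'A); have := e1 i; rewrite !mxE => ->.
  have yy i : y q i = y q' i.
    have := e2 i; rewrite !ffunE => /(congr1 val).
    have y0 : 0 <= y q i by rewrite modz_ge0.
    have yk : y q i < k.+1 by apply: ltz_pmod.
    have y0' : 0 <= y q' i by rewrite modz_ge0.
    have yk' : y q' i < k.+1 by apply: ltz_pmod.
    rewrite /= !inordK; lia.
  have cc i : centered_lift (q.1 0 i) = centered_lift (q'.1 0 i) /\ q.2 i = q'.2 i.
    have := divz_eq (m.+1%:Z * centered_lift (q.1 0 i) + (q.2 i)%:Z) k.+1.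
    rewrite -/(x q i) -/(y q i) xx yy -divz_eq.
    have := ltn_ord (q.2 i); have := ltn_ord (q'.2 i) => l l' E.
    have E1 : centered_lift (q.1 0 i) = centered_lift (q'.1 0 i) by nia.
    by split => //; apply/val_inj => /=; move: E; rewrite E1; lia.
  case: q q' {e1 e2 xx yy qA q'A} cc => [a b] [a' b'] /= cc; congr pair.
    by apply/rowP => i; rewrite -(centered_liftK (a 0 i)) (cc i).1 centered_liftK.
  by apply/ffunP => i; rewrite (cc i).2.
have -> : (#|[pred g : 'rV['F_p]_n | grid_ball t2 g]| * m.+1 ^ n = #|A|)%N.
  have -> : (m.+1 ^ n = #|{: {ffun 'I_n -> 'I_m.+1}}|)%N by rewrite card_ffun !card_ord.
  by rewrite -cardX; apply: eq_card => -[a b]; rewrite !inE andbT.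
have -> : (#|[pred g : 'rV['F_p]_n | grid_ball b2 g]| * k.+1 ^ n = #|B|)%N.
  have -> : (k.+1 ^ n = #|{: {ffun 'I_n -> 'I_k.+1}}|)%N by rewrite card_ffun !card_ord.
  by rewrite -cardX; apply: eq_card => -[a b]; rewrite !inE andbT.
rewrite -(card_in_image fI); apply: subset_leq_card; apply/fintype.subsetP => _ /fintype.imageP[q qA ->].
by rewrite inE /=; apply: grid_ball_cast; apply: xb.
Qed.
End ball.
End centered_lift.

(** * Collisions in random codebooks *)

Section codebook.
Variables (V : finZmodType) (M1 M2 : nat).
Notation books := ({ffun 'I_M1 -> V} * {ffun 'I_M2 -> V})%type.
Definition codesum (v : books) (w : 'I_M1 * 'I_M2) : V := v.1 w.1 + v.2 w.2.

(** The pairs [w] and [w'] differ in some component. Shifting the codeword of [w] in that component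
    moves [codesum v w] and leaves [codesum v w'] fixed, so the difference is uniform. *)
Lemma card_collision (S : pred V) (w w' : 'I_M1 * 'I_M2) : w' != w ->
  (#|[pred v : books | S (codesum v w - codesum v w')%R]| * #|V| = #|{: books}| * #|S|)%N.
Proof.
case: w w' => [a b] [a' b']; rewrite xpair_eqE negb_and.
have [aa /= bb|aa _] := eqVneq a' a.
- apply: (@card_shift_preim _ _ (fun v => codesum v (a, b) - codesum v (a', b')) +%R
    (fun y v => (v.1, [ffun j => if j == b then v.2 j + y else v.2 j]))).
  + exact: addrI.
  + move=> y [f g] [f' g'] [] -> /ffunP h; congr pair; apply/ffunP => j.
    by have := h j; rewrite !ffunE; case: eqP => // _ /addIr.
  + move=> y [f g]; rewrite /codesum /= !ffunE eqxx (negPf bb).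
    by rewrite !addrA -!addrA [y + _]addrC !addrA.
- apply: (@card_shift_preim _ _ (fun v => codesum v (a, b) - codesum v (a', b')) +%R
    (fun y v => ([ffun j => if j == a then v.1 j + y else v.1 j], v.2))).
  + exact: addrI.
  + move=> y [f g] [f' g'] [] /ffunP h ->; congr pair; apply/ffunP => j.
    by have := h j; rewrite !ffunE; case: eqP => // _ /addIr.
  + move=> y [f g]; rewrite /codesum /= !ffunE eqxx (negPf aa).
    by rewrite -!addrA [y + _]addrC !addrA.
Qed.
End codebook.

(** * Second moment of the Gaussian law *)

Section gaussian_second_moment.
Context {R : realType}.
Local Notation mu := (@lebesgue_measure R).

(** The left side is a supremum over simple functions below [f]. For a simple function the integral
    is a finite sum over level sets, whose probabilities are integrals of the density by
    definition. *)
Lemma le_integral_normal_prob (m s : R) (f : measurableTypeR R -> \bar R) :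
  measurable_fun setT f -> (forall x, 0 <= f x)%E ->
  (\int[normal_prob m s]_x f x <= \int[mu]_x (f x * (normal_pdf m s x)%:E))%E.
Proof.
move=> mf f0; rewrite ge0_integralTE//; apply: ge_ereal_sup => _ /= [h hf <-].
have mpdf : measurable_fun setT (fun x : measurableTypeR R => (normal_pdf m s x)%:E).
  by apply/measurable_EFinP; exact: measurable_normal_pdf.
have : (\int[mu]_x ((h x)%:E * (normal_pdf m s x)%:E) <=
    \int[mu]_x (f x * (normal_pdf m s x)%:E))%E.
  apply: ge0_le_integral => //.
  - by move=> x _; rewrite mule_ge0// lee_fin ?normal_pdf_ge0.
  - by apply: emeasurable_funM => //; exact/measurable_EFinP.
  - by apply: emeasurable_funM.
  - by move=> x _; rewrite lee_wpmul2r// lee_fin normal_pdf_ge0.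
apply: le_trans; rewrite sintegralE.
under [leRHS]eq_integral => x _.
  rewrite (fimfunE h x) -fsumEFin//.
  rewrite ge0_mule_fsuml; last first.
    by move=> r; exact: nnfun_muleindic_ge0.
  over.
rewrite ge0_integral_fsum//; last 2 first.
- move=> r; apply: emeasurable_funM => //; apply/measurable_EFinP.
  by apply: measurable_funM => //; exact: measurable_indic.
- by move=> r x _; rewrite mule_ge0 ?nnfun_muleindic_ge0// lee_fin normal_pdf_ge0.
rewrite le_eqVlt; apply/orP; left; apply/eqP; apply: eq_fsbigr => r /set_mem [x _ <-].
have hx0 : 0 <= h x by [].
under [RHS]eq_integral do rewrite EFinM -muleA.
rewrite ge0_integralZl//; last 2 first.
- by apply: emeasurable_funM => //; apply/measurable_EFinP; exact: measurable_indic.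
- by move=> y _; rewrite mule_ge0// lee_fin ?normal_pdf_ge0.
congr (_ * _)%E; transitivity (\int[mu]_(y in h @^-1` [set h x]) (normal_pdf m s y)%:E)%E => //.
rewrite [LHS]integral_mkcond; apply: eq_integral => y _.
by rewrite patchE indicE; case: ifP; rewrite ?mul1e ?mul0e.
Qed.

(* For t > s the density of variance t^2 dominates that of variance s^2 times
   (s / t) (1 + c x^2) with c = (s^-2 - t^-2) / 2; integrating bounds the second
   moment by (t / s - 1) / c = 2 s t^2 / (s + t), and t decreases to s. *)
Lemma normal_second_moment_lt (s t : R) : 0 < s -> s < t ->
  (\int[mu]_x ((x ^+ 2)%:E * (normal_pdf 0 s x)%:E) <= (2 * s * t ^+ 2 / (s + t))%:E)%E.
Proof.
move=> s0 st; have t0 := lt_trans s0 st.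
have [sn tn] : s != 0 /\ t != 0 by rewrite !gt_eqF.
pose c : R := (s ^- 2 - t ^- 2) / 2.
have c0 : 0 < c by rewrite divr_gt0// subr_gt0 ltf_pV2 ?posrE ?exprn_gt0// ltr_pXn2r// ?nnegrE ltW.
have key x : normal_pdf 0 s x + c * (x ^+ 2 * normal_pdf 0 s x) <= t / s * normal_pdf 0 t x.
  rewrite !normal_pdfE//.
  have peak : t / s * normal_peak t = normal_peak s.
    rewrite /normal_peak -!mulrnAr !(sqrtrM (pi *+ 2)) ?sqr_ge0// !sqrtr_sqr !gtr0_norm//.
    have : Num.sqrt (pi *+ 2) != 0 :> R by rewrite gt_eqF// sqrtr_gt0 mulrn_wgt0// pi_gt0.
    by move=> q0; field; rewrite sn tn q0.
  rewrite [t / s * (_ * _)]mulrA peak.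
  have -> : normal_fun 0 t x = normal_fun 0 s x * expR (c * x ^+ 2).
    rewrite /normal_fun -expRD subr0; congr expR; rewrite /c; field.
    by rewrite sn tn.
  have -> : normal_peak s * normal_fun 0 s x + c * (x ^+ 2 * (normal_peak s * normal_fun 0 s x))
    = normal_peak s * (normal_fun 0 s x * (1 + c * x ^+ 2)) by ring.
  rewrite ler_wpM2l ?normal_peak_ge0// ler_wpM2l ?normal_fun_ge0//.
  exact: expR_ge1Dx.
have mp u : measurable_fun setT (fun x : measurableTypeR R => (normal_pdf 0 u x)%:E).
  by apply/measurable_EFinP; exact: measurable_normal_pdf.
have mx : measurable_fun setT (fun x : measurableTypeR R => (x ^+ 2)%:E * (normal_pdf 0 s x)%:E)%E.
  by apply: emeasurable_funM => //; apply/measurable_EFinP; exact: measurable_funX.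
have p0 u x : (0 <= (normal_pdf 0 u x)%:E)%E by rewrite lee_fin normal_pdf_ge0.
have x0 x : (0 <= (x ^+ 2)%:E * (normal_pdf 0 s x)%:E)%E by rewrite mule_ge0// lee_fin sqr_ge0.
set I := integral _ _ _.
have : (1 + c%:E * I <= (t / s)%:E)%E.
  rewrite -[leRHS]mule1 -[in leRHS](@integral_normal_pdf _ 0 t) -[in leLHS](@integral_normal_pdf _ 0 s).
  rewrite /I -[X in (_ + X <= _)%E]ge0_integralZl_EFin ?(ltW c0)//.
  rewrite -[leRHS]ge0_integralZl_EFin ?divr_ge0 ?(ltW s0) ?(ltW t0)//.
  rewrite -ge0_integralD//; last 2 first.
  - by move=> x _; rewrite mule_ge0// lee_fin ltW.
  - by apply: emeasurable_funM => //; apply/measurable_EFinP.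
  apply: ge0_le_integral => //.
  - by move=> x _; rewrite adde_ge0// mule_ge0// lee_fin ltW.
  - by apply: emeasurable_funD => //; apply: emeasurable_funM.
  - by apply: emeasurable_funM.
  - by move=> x _; rewrite -!EFinM -EFinD lee_fin.
have : (0 <= I)%E by apply: integral_ge0 => x _; exact: x0.
case: I => // [I I0|_]; last first.
  by rewrite gt0_muley ?lte_fin// addey.
rewrite -EFinM -EFinD !lee_fin => H.
have -> : 2 * s * t ^+ 2 / (s + t) = (t / s - 1) / c.
  have d0 : t ^+ 2 - s ^+ 2 != 0 by rewrite gt_eqF// subr_gt0 ltr_pXn2r ?nnegrE ?ltW.
  have st0 : s + t != 0 by rewrite gt_eqF// addr_gt0.
  by rewrite /c; field; rewrite sn tn mulN1r d0 st0.
by rewrite ler_pdivlMr// lerBrDl mulrC.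
Qed.

Lemma normal_second_moment (s : R) : 0 < s ->
  (\int[mu]_x ((x ^+ 2)%:E * (normal_pdf 0 s x)%:E) <= (s ^+ 2)%:E)%E.
Proof.
move=> s0; apply/lee_addgt0Pr => e e0.
(* With [t = s + h] and [h <= s], the bound exceeds [s ^+ 2] by at most [5 * s * h / 2], so
   [h <= e / (6 * s)] is small enough. *)
pose t := s + Num.min s (e / (6 * s)).
have m0 : 0 < Num.min s (e / (6 * s)) by rewrite lt_min s0 divr_gt0// mulr_gt0.
apply: (le_trans (@normal_second_moment_lt s t s0 _)); first by rewrite ltrDl.
rewrite -EFinD lee_fin ler_pdivrMr ?addr_gt0 ?ltrDl//.
move: m0; rewrite /t; set h := Num.min _ _ => m0.
have hs : h <= s by rewrite ge_min lexx.
have : h <= e / (6 * s) by rewrite ge_min lexx orbT.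
rewrite ler_pdivlMr ?mulr_gt0// => he.
nra.
Qed.

Lemma noise_second_moment (N : R) : 0 < N ->
  (\int[noise_law N]_x (x ^+ 2)%:E <= N%:E)%E.
Proof.
move=> N0.
have mid : measurable_fun setT (idfun : measurableTypeR R -> R) by move=> _ A mA; rewrite setTI.
(* [noise_law] and [normal_prob] agree as set functions but live over different displays of the real
   line; pushing forward along the identity changes the display. *)
have -> : (\int[noise_law N]_x (x ^+ 2)%:E =
    \int[pushforward (normal_prob 0 (Num.sqrt N)) (idfun : measurableTypeR R -> R)]_x (x ^+ 2)%:E)%E.
  exact: eq_measure_integral.
rewrite ge0_integral_pushforward//; last 2 first.
- by apply/measurable_EFinP; exact: measurable_funX.
- by move=> x _; rewrite lee_fin sqr_ge0.
apply: le_trans (le_integral_normal_prob _ _ _ _) _.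
- by apply/measurable_EFinP; exact: measurable_funX.
- by move=> x; rewrite lee_fin sqr_ge0.
rewrite -[in leRHS](sqr_sqrtr (ltW N0)); apply: normal_second_moment.
by rewrite sqrtr_gt0.
Qed.

End gaussian_second_moment.

(** * Weak law for i.i.d. vectors *)

Lemma measurable_sum_ord d (T : measurableType d) (R : realType) n (h : 'I_n -> T -> R) :
  (forall i, measurable_fun setT (h i)) ->
  measurable_fun setT (fun x => \sum_(i < n) h i x).
Proof.
move=> mh; elim: n h mh => [|n IH] h mh.
  by rewrite (_ : (fun _ => _) = cst 0)//; apply/funext => x; rewrite big_ord0.
rewrite (_ : (fun _ => _) = (fun x => h ord0 x + \sum_(i < n) h (lift ord0 i) x)).
  by apply: measurable_funD => //; apply: IH.
by apply/funext => x; rewrite big_ord_recl.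
Qed.

Lemma measurable_lin_tnth d (T : measurableType d) (R : realType) n (f : T -> R)
  (a : 'I_n -> R -> R) : measurable_fun setT f ->
  (forall i, measurable_fun setT (a i)) ->
  measurable_fun setT (fun s : n.-tuple T => \sum_(i < n) a i (f (tnth s i))).
Proof.
move=> mf ma; apply: measurable_sum_ord => i.
apply: (measurableT_comp (ma i)); apply: (measurableT_comp mf).
exact: measurable_tnth.
Qed.

Lemma markov_real d (T : measurableType d) (R : realType) (mu : {measure set T -> \bar R})
    (h : T -> R) (a b : R) : measurable_fun setT h -> (forall x, 0 <= h x) -> 0 < a ->
  (\int[mu]_x (h x)%:E <= b%:E)%E -> (mu [set x | (a <= h x)%R] <= (b / a)%:E)%E.
Proof.
move=> mh h0 a0 hb.
have := @le_integral_comp_abse _ _ _ mu _ measurableT (EFin \o h) a (fun x => x) _ _ _ _ a0.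
rewrite setTI /= => H.
rewrite -(@lee_pmul2l _ a%:E)//.
have -> : (a%:E * (b / a)%:E = b%:E)%E by rewrite -EFinM mulrC divfK// gt_eqF.
apply: le_trans hb.
have e : (\int[mu]_x (h x)%:E = \int[mu]_x `|(h x)%:E|)%E.
  by apply: eq_integral => x _; rewrite gee0_abs// lee_fin.
rewrite e.
have -> : [set x | a <= h x] = [set x | (a%:E <= `|(h x)%:E|)%E].
  by apply/seteqP; split => x /=; rewrite ger0_norm// lee_fin.
by apply: H => //; exact/measurable_EFinP.
Qed.

Lemma integral_prob_cst d (T : measurableType d) (R : realType) (P : probability T R)
  (k : R) : (\int[P]__ k%:E = k%:E)%E.
Proof.
have := @integral_cst _ T R P _ measurableT k%:E.
by rewrite [X in (_ * X)%E](@probability_setT _ _ _ P) mule1.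
Qed.

Section iid_moments.
Context {d : measure_display} {T : measurableType d} {R : realType}.
Variable Q : probability T R.

Lemma ge0_integral_iid_cons n (F : n.+1.-tuple T -> \bar R) :
  measurable_fun setT F -> (forall s, 0 <= F s)%E ->
  (\int[iid_law Q n.+1]_s F s = \int[Q]_x \int[iid_law Q n]_y F (consT (x, y)))%E.
Proof.
move=> mF F0; rewrite /= ge0_integral_distribution//.
rewrite (@fubini_tonelli1 _ _ _ _ _ Q (iid_law Q n) (F \o @consT _ _ n))//.
by apply: measurableT_comp => //; exact: measurable_consT.
by move=> x; exact: F0.
Qed.

(** The hypothesis on [f] packs mean 0 and second moment [K] into one affine formula. The constant
    [c] serves the induction: the first sample joins it while the remaining ones are integrated. *)
Lemma iid_second_moment n (f : T -> R) (K c : R) (x : 'I_n -> R) :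
  measurable_fun setT f ->
  (forall a b : R, (\int[Q]_t ((a + b * f t) ^+ 2)%:E = (a ^+ 2 + b ^+ 2 * K)%:E)%E) ->
  (\int[iid_law Q n]_s ((c + \sum_(i < n) x i * f (tnth s i)) ^+ 2)%:E =
    (c ^+ 2 + (\sum_(i < n) x i ^+ 2) * K)%:E)%E.
Proof.
move=> mf hf.
have mS m (c' : R) (y : 'I_m -> R) : measurable_fun setT
    (fun s : m.-tuple T => ((c' + \sum_(i < m) y i * f (tnth s i)) ^+ 2)%:E).
  apply/measurable_EFinP; apply: measurable_funX; apply: measurable_funD => //.
  by apply: (measurable_lin_tnth (a := fun i z => y i * z)) => // i; exact: measurable_funM.
elim: n c x => [|n IH] c x.
  have := @integral_dirac _ _ ([tuple] : 0.-tuple T) R _ measurableT _ (mS 0%N c x).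
  by rewrite diracT mul1e !big_ord0 => ->; congr EFin; ring.
rewrite ge0_integral_iid_cons//; last by move=> s; rewrite lee_fin sqr_ge0.
set S := \sum_(i < n) x (lift ord0 i) ^+ 2.
have K0 : 0 <= K.
  rewrite -lee_fin; have := hf 0 1; rewrite expr0n expr1n mul1r add0r => <-.
  by apply: integral_ge0 => t _; rewrite lee_fin sqr_ge0.
transitivity (\int[Q]_t ((S * K)%:E + ((c + x ord0 * f t) ^+ 2)%:E)%E)%E.
  apply: eq_integral => t _.
  transitivity (\int[iid_law Q n]_y (((c + x ord0 * f t) + \sum_(i < n) x (lift ord0 i) * f (tnth y i)) ^+ 2)%:E)%E.
    apply: eq_integral => y _; rewrite big_ord_recl addrA; congr (_ ^+ 2)%:E; congr (_ + _).
    by apply: eq_bigr => i _; rewrite tnthS.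
  by rewrite IH -EFinD addrC.
rewrite ge0_integralD//.
- rewrite integral_prob_cst hf big_ord_recl -EFinD; congr EFin.
  by rewrite -/S; ring.
- by move=> t _; rewrite lee_fin mulr_ge0// sumr_ge0// => i _; rewrite sqr_ge0.
- by move=> t _; rewrite lee_fin sqr_ge0.
- apply/measurable_EFinP; apply: measurable_funX; apply: measurable_funD => //.
  exact: measurable_funM.
Qed.

Lemma iid_mean n (g : T -> R) (c K : R) :
  measurable_fun setT g -> (forall t, 0 <= g t) -> 0 <= c ->
  (\int[Q]_t (g t)%:E = K%:E)%E ->
  (\int[iid_law Q n]_s (c + \sum_(i < n) g (tnth s i))%:E = (c + n%:R * K)%:E)%E.
Proof.
move=> mg g0 + hg; have K0 : 0 <= K.
  by rewrite -lee_fin -hg; apply: integral_ge0 => t _; rewrite lee_fin.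
have mS m (c' : R) : measurable_fun setT
    (fun s : m.-tuple T => (c' + \sum_(i < m) g (tnth s i))%:E).
  apply/measurable_EFinP; apply: measurable_funD => //.
  exact: (measurable_lin_tnth (a := fun i y => y)).
elim: n c => [|n IH] c c0.
  have := @integral_dirac _ _ ([tuple] : 0.-tuple T) R _ measurableT _ (mS 0%N c).
  by rewrite diracT mul1e !big_ord0 => ->; congr EFin; ring.
rewrite ge0_integral_iid_cons//; last by move=> s; rewrite lee_fin addr_ge0// sumr_ge0.
transitivity (\int[Q]_t ((c + n%:R * K)%:E + (g t)%:E)%E)%E.
  apply: eq_integral => t _.
  transitivity (\int[iid_law Q n]_y ((c + g t) + \sum_(i < n) g (tnth y i))%:E)%E.
    apply: eq_integral => y _; rewrite big_ord_recl addrA; congr (_ + _)%:E.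
    by apply: eq_bigr => i _; rewrite tnthS.
  by rewrite IH ?addr_ge0// -EFinD; congr EFin; ring.
rewrite ge0_integralD//.
- rewrite integral_prob_cst hg -EFinD; congr EFin.
  by rewrite -natr1; ring.
- by move=> t _; rewrite lee_fin addr_ge0// mulr_ge0.
- by move=> t _; rewrite lee_fin.
- exact/measurable_EFinP.
Qed.

Lemma sqr_affine_integral (f : T -> R) (K : R) : measurable_fun setT f ->
  Q.-integrable setT (EFin \o f) -> (\int[Q]_t (f t)%:E = 0)%E ->
  (\int[Q]_t (f t ^+ 2)%:E = K%:E)%E ->
  forall a b : R, (\int[Q]_t ((a + b * f t) ^+ 2)%:E = (a ^+ 2 + b ^+ 2 * K)%:E)%E.
Proof.
move=> mf intf f1 f2 a b.
have intf2 : Q.-integrable setT (EFin \o (fun t => f t ^+ 2)).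
  apply/integrableP; split; first by apply/measurable_EFinP; exact: measurable_funX.
  rewrite (_ : integral _ _ _ = K%:E) ?ltry// -f2; apply: eq_integral => t _ /=.
  by rewrite ger0_norm// sqr_ge0.
transitivity (\int[Q]_t ((a ^+ 2)%:E + ((2 * a * b)%:E * (f t)%:E + (b ^+ 2)%:E * (f t ^+ 2)%:E)))%E.
  by apply: eq_integral => t _; rewrite -!EFinM -!EFinD; congr EFin; ring.
have i1 := integrableZl measurableT (2 * a * b) intf.
have i2 := integrableZl measurableT (b ^+ 2) intf2.
rewrite integralD//; last 2 first.
- exact: finite_measure_integrable_cst.
- exact: (integrableD measurableT i1 i2).
rewrite integral_prob_cst integralD// !integralZl//.
by rewrite f1 f2 mule0 add0e -EFinM -EFinD.
Qed.

End iid_moments.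

Lemma measurable_real_le d (T : measurableType d) (R : realType) (f : T -> R) (c : R) :
  measurable_fun setT f -> measurable [set x | c <= f x].
Proof.
move=> mf; rewrite -[X in measurable X]setTI (_ : [set x | _] = f @^-1` `[c, +oo[%classic).
  exact: mf.
by apply/seteqP; split => x /=; rewrite in_itv/= andbT.
Qed.

Lemma measurable_real_lt d (T : measurableType d) (R : realType) (f : T -> R) (c : R) :
  measurable_fun setT f -> measurable [set x | c < f x].
Proof.
move=> mf; rewrite -[X in measurable X]setTI (_ : [set x | _] = f @^-1` `]c, +oo[%classic).
  exact: mf.
by apply/seteqP; split => x /=; rewrite in_itv/= andbT.
Qed.

Section weak_law.
Context {d : measure_display} {T : measurableType d} {R : realType}.
Variable Q : probability T R.

(** Monotone convergence: the truncations of [g] at level [n] increase to [g], being equal to it at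
    each point from some [n] on. *)
Lemma truncation_tail (g : T -> R) (K e : R) : measurable_fun setT g ->
  (forall t, 0 <= g t) -> (\int[Q]_t (g t)%:E = K%:E)%E -> 0 < e ->
  exists2 L : R, 0 < L & (\int[Q]_t (g t - Num.min (g t) L)%:E <= e%:E)%E.
Proof.
move=> mg g0 hg e0.
pose u n t := (Num.min (g t) n%:R)%:E : \bar R.
have mu n : measurable_fun setT (u n) by apply/measurable_EFinP; exact: measurable_minr.
have u0 n t : (0 <= u n t)%E by rewrite lee_fin le_min g0 ler0n.
have nd t : {homo u^~ t : a b / (a <= b)%N >-> (a <= b)%E}.
  move=> a b ab; rewrite lee_fin le_min ge_min lexx /= ge_min ler_nat ab orbT.
  by [].
have H := @cvg_monotone_convergence _ _ _ Q _ measurableT u mu (fun n x _ => u0 n x) (fun x _ => @nd x).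
have ulim : (fun t => limn (u^~ t)) = (fun t => (g t)%:E).
  apply/funext => t; apply/cvg_lim => //; apply: cvg_near_cst.
  exists (Num.truncn (g t)).+1 => // n /= nt; rewrite /u min_l//.
  by apply: ltW; apply: lt_le_trans (truncnS_gt _) _; rewrite ler_nat.
have := H; under eq_integral do rewrite (congr1 (fun f => f _) ulim).
rewrite hg => {}H.
have [n [n0 hn]] : exists n, (0 < n)%N /\ ((K - e)%:E < \int[Q]_t u n t)%E.
  have /(H _)[n0 _ hn] : nbhs (K%:E : \bar R) [set y | ((K - e)%:E < y)%E].
    apply: open_nbhs_nbhs; split; first exact: open_ereal_gt_ereal.
    by rewrite /= lte_fin ltrBlDr ltrDl.
  by exists n0.+1; split=> //; apply: (hn n0.+1) => /=.
exists n%:R; first by rewrite ltr0n.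
have : (\int[Q]_t (g t)%:E = \int[Q]_t u n t + \int[Q]_t (g t - Num.min (g t) n%:R)%:E)%E.
  rewrite -ge0_integralD//.
  - by apply: eq_integral => t _; rewrite /u -EFinD addrC subrK.
  - by move=> t _; rewrite lee_fin subr_ge0 ge_min lexx.
  - by apply/measurable_EFinP; apply: measurable_funB => //; exact: measurable_minr.
rewrite hg; move: hn.
have : (0 <= \int[Q]_t u n t)%E by apply: integral_ge0.
have : (0 <= \int[Q]_t (g t - Num.min (g t) n%:R)%:E)%E.
  by apply: integral_ge0 => t _; rewrite lee_fin subr_ge0 ge_min lexx.
case: (integral _ _ _) => [a||]//; case: (integral _ _ _) => [b||]//= _ _.
rewrite lte_fin => hb [] hK; rewrite lee_fin; lra.
Qed.

(** The scalar product of a fixed [y] with the samples has mean 0 and variance at most [n * A * K],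
    one order below [(n * dl) ^+ 2]. The resulting decay is uniform in [y]. *)
Lemma iid_cross n (f : T -> R) (y : 'I_n -> R) (A K dl : R) : measurable_fun setT f ->
  (forall a b : R, (\int[Q]_t ((a + b * f t) ^+ 2)%:E = (a ^+ 2 + b ^+ 2 * K)%:E)%E) ->
  0 <= K -> 0 < dl -> (0 < n)%N -> \sum_i y i ^+ 2 <= n%:R * A ->
  (iid_law Q n [set s | ((n%:R * dl) ^+ 2 <= (\sum_i y i * f (tnth s i)) ^+ 2)%R]
     <= (A * K / (n%:R * dl ^+ 2))%:E)%E.
Proof.
move=> mf hf K0 dl0 n0 hy.
have nR : 0 < n%:R :> R by rewrite ltr0n.
have -> : A * K / (n%:R * dl ^+ 2) = (n%:R * A) * K / (n%:R * dl) ^+ 2.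
  by field; rewrite !gt_eqF.
apply: markov_real.
- apply: measurable_funX.
  by apply: (measurable_lin_tnth (a := fun i z => y i * z)) => // i; exact: measurable_funM.
- by move=> s; rewrite sqr_ge0.
- by rewrite exprn_gt0 ?mulr_gt0.
- rewrite (eq_integral (fun s => ((0 + \sum_i y i * f (tnth s i)) ^+ 2)%:E)); last first.
    by move=> s _; rewrite add0r.
  by rewrite (iid_second_moment 0 y mf hf) expr0n add0r lee_fin ler_wpM2r.
Qed.

(* Only the mean of g is finite: Chebyshev's inequality is applied to a truncation
   of g and Markov's inequality to the remaining tail. *)
Lemma iid_weak_law (g : T -> R) (K dl e : R) : measurable_fun setT g ->
  (forall t, 0 <= g t) -> (\int[Q]_t (g t)%:E = K%:E)%E -> 0 < dl -> 0 < e ->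
  exists n0, forall n, (n0 <= n)%N ->
  (iid_law Q n [set s | (n%:R * (K + dl) <= \sum_i g (tnth s i))%R] <= e%:E)%E.
Proof.
move=> mg g0 hg dl0 e0.
have ed : 0 < e * dl / 4 by rewrite divr_gt0 ?mulr_gt0.
(* A tail of mean at most [e * dl / 4] reaches [dl / 2] per symbol with probability at most [e / 2],
   by Markov's inequality. *)
have [L L0 hL] := truncation_tail mg g0 hg ed.
pose u t := Num.min (g t) L; pose v t := g t - u t.
have muu : measurable_fun setT u by exact: measurable_minr.
have mv : measurable_fun setT v by exact: measurable_funB.
have u0 t : 0 <= u t by rewrite le_min g0 ltW.
have uL t : u t <= L by rewrite ge_min lexx orbT.
have v0 t : 0 <= v t by rewrite subr_ge0 ge_min lexx.
have [eta heta etale] : exists2 eta, (\int[Q]_t (v t)%:E = eta%:E)%E & eta <= e * dl / 4.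
  move: hL; have : (0 <= \int[Q]_t (v t)%:E)%E by apply: integral_ge0 => t _; rewrite lee_fin.
  by rewrite -/(v _); case: (integral _ _ _) => // a _; rewrite lee_fin; exists a.
have iu : Q.-integrable setT (EFin \o u).
  apply: measurable_bounded_integrable => //; first by rewrite (le_lt_trans (probability_le1 _ _)) ?ltry.
  exists L; split; first by rewrite num_real.
  by move=> M LM t _ /=; rewrite ger0_norm// (le_trans (uL t))// ltW.
have [m hm] : exists m, (\int[Q]_t (u t)%:E = m%:E)%E.
  by exists (fine (\int[Q]_t (u t)%:E)%E); rewrite fineK//; exact: integrable_fin_num.
have m0 : 0 <= m by rewrite -lee_fin -hm; apply: integral_ge0 => t _; rewrite lee_fin.
have mL : m <= L.
  rewrite -lee_fin -hm -[leRHS](integral_prob_cst Q); apply: ge0_le_integral => //; do ?exact/measurable_EFinP;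
    by move=> t _; rewrite lee_fin.
have mK : m <= K.
  rewrite -lee_fin -hm -hg; apply: ge0_le_integral => //; do ?exact/measurable_EFinP;
    by move=> t _; rewrite lee_fin// ge_min lexx.
pose w t := u t - m.
have mw : measurable_fun setT w by exact: measurable_funB.
have wL t : w t ^+ 2 <= L ^+ 2.
  have a1 : 0 <= L - w t by have := uL t; rewrite /w; lra.
  have a2 : 0 <= L + w t by have := u0 t; rewrite /w; lra.
  by have := mulr_ge0 a1 a2; lra.
have iw : Q.-integrable setT (EFin \o w).
  apply: (eq_integrable measurableT (EFin \o u \- cst m%:E)%E) => //.
  by apply: integrableB => //; exact: finite_measure_integrable_cst.
have w1 : (\int[Q]_t (w t)%:E = 0)%E.
  rewrite (eq_integral (fun t => (EFin \o u) t - (cst m%:E) t)%E)//.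
  rewrite integralB//; last exact: finite_measure_integrable_cst.
  by rewrite hm integral_prob_cst subee.
have [V hV VL] : exists2 V, (\int[Q]_t (w t ^+ 2)%:E = V%:E)%E & V <= L ^+ 2.
  have : (\int[Q]_t (w t ^+ 2)%:E <= (L ^+ 2)%:E)%E.
    rewrite -[leRHS](integral_prob_cst Q); apply: ge0_le_integral => //.
    - by move=> t _; rewrite lee_fin sqr_ge0.
    - by apply/measurable_EFinP; exact: measurable_funX.
    - by move=> t _; rewrite lee_fin.
  have : (0 <= \int[Q]_t (w t ^+ 2)%:E)%E by apply: integral_ge0 => t _; rewrite lee_fin sqr_ge0.
  by case: (integral _ _ _) => // a _; rewrite lee_fin; exists a.
have V0 : 0 <= V by rewrite -lee_fin -hV; apply: integral_ge0 => t _; rewrite lee_fin sqr_ge0.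
have hw := sqr_affine_integral mw iw w1 hV.
(* Chebyshev's inequality at level [dl / 2] gives [4 * L ^+ 2 / (n * dl ^+ 2)], which is at most
   [e / 2] from this length on. *)
exists (Num.truncn (8 * L ^+ 2 / (dl ^+ 2 * e))).+1 => n hn.
have n0 : (0 < n)%N by apply: leq_ltn_trans hn.
have nR : 0 < n%:R :> R by rewrite ltr0n.
have nbig : 8 * L ^+ 2 / (dl ^+ 2 * e) <= n%:R.
  by apply: ltW; apply: lt_le_trans (truncnS_gt _) _; rewrite ler_nat.
pose A1 := [set s : n.-tuple T | n%:R * (dl / 2) <= \sum_i v (tnth s i)].
pose A2 := [set s : n.-tuple T | (n%:R * (dl / 2)) ^+ 2 <= (\sum_i 1 * w (tnth s i)) ^+ 2].
have msum (h : T -> R) : measurable_fun setT h ->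
    measurable_fun setT (fun s : n.-tuple T => \sum_i h (tnth s i)).
  by move=> mh; apply: (measurable_lin_tnth (a := fun i z => z)).
have mA1 : measurable A1 by apply: measurable_real_le; exact: msum.
have mA2 : measurable A2.
  apply: measurable_real_le; apply: measurable_funX.
  by apply: (measurable_lin_tnth (a := fun i z => 1 * z)) => // i; exact: measurable_funM.
have d2 : 0 < dl / 2 by rewrite divr_gt0.
have P1 : (iid_law Q n A1 <= (e / 2)%:E)%E.
  have -> : e / 2 = n%:R * (e * dl / 4) / (n%:R * (dl / 2)).
    by field; rewrite !gt_eqF.
  apply: markov_real; first exact: msum.
  - by move=> s; rewrite sumr_ge0.
  - by rewrite mulr_gt0.
  - rewrite (eq_integral (fun s => (0 + \sum_i v (tnth s i))%:E)); last first.
      by move=> s _; rewrite add0r.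
    by rewrite (iid_mean n mv v0 (lexx 0) heta) add0r lee_fin ler_wpM2l.
have P2 : (iid_law Q n A2 <= (e / 2)%:E)%E.
  apply: (le_trans (@iid_cross n w (fun=> 1) 1 V (dl / 2) mw hw V0 d2 n0 _)).
    by rewrite expr1n sumr_const card_ord mulr1.
  rewrite lee_fin mul1r ler_pdivrMr ?mulr_gt0 ?exprn_gt0//.
  apply: (le_trans VL); move: nbig; rewrite ler_pdivrMr ?mulr_gt0 ?exprn_gt0//; nra.
have -> : e = e / 2 + e / 2 by lra.
rewrite EFinD; apply: le_trans (leeD P1 P2).
apply: le_trans (measureU2 _ mA1 mA2); apply: le_measure; rewrite ?inE//.
- by apply: measurable_real_le; exact: msum.
- exact: measurableU.
move=> s /= hs; have [h1|h1] := leP (n%:R * (dl / 2)) (\sum_i v (tnth s i)); [by left|right].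
rewrite /A2 /=; under eq_bigr do rewrite mul1r.
have gE : \sum_i g (tnth s i) = \sum_i v (tnth s i) + \sum_i w (tnth s i) + n%:R * m.
  rewrite -[in n%:R](card_ord n) mulr_natl -sumr_const -!big_split /=.
  by apply: eq_bigr => i _; rewrite /w /v; ring.
have h2 : n%:R * (dl / 2) <= \sum_i w (tnth s i).
  have : n%:R * m <= n%:R * K by rewrite ler_wpM2l.
  by move: hs h1; rewrite gE mulrDr; lra.
by rewrite lerXn2r ?nnegrE ?(le_trans _ h2)// mulr_ge0// ltW.
Qed.

(** The square is expanded: [iid_weak_law] bounds the energy of the samples and [iid_cross] the
    cross term. It matters that [n0] is chosen before [y], since [y] will depend on other random
    sources. *)
Lemma iid_shifted_norm (f : T -> R) (K A dl e : R) : measurable_fun setT f ->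
  Q.-integrable setT (EFin \o f) -> (\int[Q]_t (f t)%:E = 0)%E ->
  (\int[Q]_t (f t ^+ 2)%:E = K%:E)%E -> 0 <= A -> 0 < dl -> 0 < e ->
  exists n0, forall n, (n0 <= n)%N -> forall y : 'I_n -> R,
  \sum_i y i ^+ 2 <= n%:R * A ->
  (iid_law Q n [set s | (n%:R * (A + K + dl) < \sum_i (y i + f (tnth s i)) ^+ 2)%R]
    <= e%:E)%E.
Proof.
move=> mf intf f1 f2 A0 dl0 e0.
have K0 : 0 <= K by rewrite -lee_fin -f2; apply: integral_ge0 => t _; rewrite lee_fin sqr_ge0.
have d2 : 0 < dl / 2 by rewrite divr_gt0.
have d4 : 0 < dl / 4 by rewrite divr_gt0.
have e2 : 0 < e / 2 by rewrite divr_gt0.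
have hf := sqr_affine_integral mf intf f1 f2.
have [n1 H1] := iid_weak_law (measurable_funX 2 mf) (fun t => sqr_ge0 (f t)) f2 d2 e2.
(* The cross term is counted twice, so it is cut at [dl / 4]; [16 * A * K / (n * dl ^+ 2)] is at
   most [e / 2] from this length on. *)
exists (maxn n1 (Num.truncn (32 * (A * K) / (dl ^+ 2 * e))).+1) => n.
rewrite geq_max => /andP[/H1{}H1 hn] y hy.
have n0 : (0 < n)%N by apply: leq_ltn_trans hn.
have nR : 0 < n%:R :> R by rewrite ltr0n.
have nbig : 32 * (A * K) / (dl ^+ 2 * e) <= n%:R.
  by apply: ltW; apply: lt_le_trans (truncnS_gt _) _; rewrite ler_nat.
have H2 := iid_cross mf hf K0 d4 n0 hy.
have {}H2 := le_trans H2 (_ : _ <= (e / 2)%:E)%E.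
have -> : e = e / 2 + e / 2 by lra.
rewrite EFinD; apply: le_trans (leeD H1 (H2 _)); last first.
  rewrite lee_fin ler_pdivrMr ?mulr_gt0 ?exprn_gt0//.
  move: nbig; rewrite ler_pdivrMr ?mulr_gt0 ?exprn_gt0//; nra.
have mA1 : measurable [set s : n.-tuple T | n%:R * (K + dl / 2) <= \sum_i f (tnth s i) ^+ 2].
  apply: measurable_real_le; apply: (measurable_lin_tnth (a := fun i z => z ^+ 2)) => //.
have mA2 : measurable [set s : n.-tuple T | (n%:R * (dl / 4)) ^+ 2 <= (\sum_i y i * f (tnth s i)) ^+ 2].
  apply: measurable_real_le; apply: measurable_funX.
  by apply: (measurable_lin_tnth (a := fun i z => y i * z)) => // i; exact: measurable_funM.
apply: le_trans (measureU2 _ mA1 mA2); apply: le_measure; rewrite ?inE//.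
- apply: measurable_real_lt; apply: (measurable_lin_tnth (a := fun i z => (y i + z) ^+ 2)) => // i.
  by apply: measurable_funX; exact: measurable_funD.
- exact: measurableU.
move=> s /= hs.
have [h1|h1] := leP (n%:R * (K + dl / 2)) (\sum_i f (tnth s i) ^+ 2); [by left|right].
have sE : \sum_i (y i + f (tnth s i)) ^+ 2 =
    \sum_i y i ^+ 2 + 2 * (\sum_i y i * f (tnth s i)) + \sum_i f (tnth s i) ^+ 2.
  by rewrite mulr_sumr -!big_split /=; apply: eq_bigr => i _; ring.
have h2 : n%:R * (dl / 4) <= \sum_i y i * f (tnth s i).
  by move: hs hy h1; rewrite sE !mulrDr; lra.
by rewrite lerXn2r ?nnegrE ?(le_trans _ h2)// mulr_ge0// ltW.
Qed.
End weak_law.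

(** * Norm of a sum of three independent noises *)

Section three_sources.
Context {R : realType}.

(** Fubini, with the probability of a section bounded by 1 over the exceptional set [B] and by [e2]
    elsewhere. *)
Lemma product_measure_le d1 d2 (X : measurableType d1) (Y : measurableType d2)
    (P1 : probability X R) (P2 : probability Y R) (B : set X) (A : set (X * Y)) (e1 e2 : R) :
  measurable B -> measurable A -> 0 <= e2 -> (P1 B <= e1%:E)%E ->
  (forall x, ~ B x -> (P2 (xsection A x) <= e2%:E)%E) ->
  ((P1 \x P2) A <= (e1 + e2)%:E)%E.
Proof.
move=> mB mA e20 hB hA.
have : (\int[P1]_x P2 (xsection A x) <= \int[P1]_x ((\1_B x)%:E + e2%:E))%E.
  apply: ge0_le_integral => //.
  - exact: measurable_fun_xsection.
  - by apply: emeasurable_funD => //; apply/measurable_EFinP; exact: measurable_indic.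
  - move=> x _; rewrite indicE; have [Bx|Bx] := boolP (x \in B).
      by rewrite (le_trans (probability_le1 _ _))// ?leeDl ?lee_fin//; exact: measurable_xsection.
    by rewrite add0e; apply: hA; move/negP: Bx; rewrite inE.
rewrite ge0_integralD//; last by apply/measurable_EFinP; exact: measurable_indic.
rewrite integral_indic// setIT integral_prob_cst => H.
by apply: (le_trans H); rewrite EFinD leeD2r.
Qed.

Context {d1 d2 d3 : measure_display} {T1 : measurableType d1}
  {T2 : measurableType d2} {T3 : measurableType d3}.
Variables (Q1 : probability T1 R) (Q2 : probability T2 R) (Q3 : probability T3 R).

Definition centered d (T : measurableType d) (Q : probability T R) (f : T -> R) (K : R) :=
  [/\ measurable_fun setT f, Q.-integrable setT (EFin \o f),
    (\int[Q]_t (f t)%:E = 0)%E & (\int[Q]_t (f t ^+ 2)%:E = K%:E)%E].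

(** The sources are added one at a time. Given the earlier ones, the vector accumulated so far is a
    fixed [y] for [iid_shifted_norm], whose uniformity in [y] permits the conditioning; each source
    uses a third of [dl] and of [e]. *)
Lemma noise_norm (f1 : T1 -> R) (f2 : T2 -> R) (f3 : T3 -> R) (K1 K2 K3 A dl e : R) :
  centered Q1 f1 K1 -> centered Q2 f2 K2 -> centered Q3 f3 K3 ->
  0 <= A -> 0 < dl -> 0 < e ->
  exists n0, forall n, (n0 <= n)%N -> forall y : 'I_n -> R,
  \sum_i y i ^+ 2 <= n%:R * A ->
  ((iid_law Q1 n \x iid_law Q2 n \x iid_law Q3 n)
    [set s | (n%:R * (A + K1 + K2 + K3 + dl) <
      \sum_i (y i + f1 (tnth s.1.1 i) + f2 (tnth s.1.2 i) + f3 (tnth s.2 i)) ^+ 2)%R]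
    <= e%:E)%E.
Proof.
move=> [m1 i1 z1 q1] [m2 i2 z2 q2] [m3 i3 z3 q3] A0 dl0 e0.
have K10 : 0 <= K1 by rewrite -lee_fin -q1; apply: integral_ge0 => t _; rewrite lee_fin sqr_ge0.
have K20 : 0 <= K2 by rewrite -lee_fin -q2; apply: integral_ge0 => t _; rewrite lee_fin sqr_ge0.
have dl3 : 0 < dl / 3 by rewrite divr_gt0.
have e3 : 0 < e / 3 by rewrite divr_gt0.
have A1 : 0 <= A + K1 + dl / 3 by rewrite !addr_ge0// ltW.
have A2 : 0 <= A + K1 + dl / 3 + K2 + dl / 3 by rewrite !addr_ge0// ltW.
have [n1 H1] := iid_shifted_norm m1 i1 z1 q1 A0 dl3 e3.
have [n2 H2] := iid_shifted_norm m2 i2 z2 q2 A1 dl3 e3.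
have [n3 H3] := iid_shifted_norm m3 i3 z3 q3 A2 dl3 e3.
exists (maxn n1 (maxn n2 n3)) => n; rewrite !geq_max => /and3P[hn1 hn2 hn3] y hy.
have mt d (T : measurableType d) d' (X : measurableType d') (f : T -> R) (g : X -> n.-tuple T) i :
    measurable_fun setT f -> measurable_fun setT g ->
    measurable_fun setT (fun x => f (tnth (g x) i)).
  move=> mf mg; apply: (measurableT_comp mf).
  exact: (measurableT_comp (measurable_tnth i) mg).
have -> : e = e / 3 + e / 3 + e / 3 by lra.
pose B2 := [set s : n.-tuple T1 * n.-tuple T2 | n%:R * (A + K1 + dl / 3 + K2 + dl / 3) <
  \sum_i (y i + f1 (tnth s.1 i) + f2 (tnth s.2 i)) ^+ 2].
have mB2 : measurable B2.
  apply: measurable_real_lt; apply: measurable_sum_ord => i; apply: measurable_funX.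
  by do ?apply: measurable_funD => //; apply: mt.
apply: (@product_measure_le _ _ _ _ _ _ B2) => //.
- apply: measurable_real_lt; apply: measurable_sum_ord => i; apply: measurable_funX.
  by do ?apply: measurable_funD => //; apply: mt => //; apply: measurableT_comp.
- exact: ltW.
- pose B1 := [set s : n.-tuple T1 | n%:R * (A + K1 + dl / 3) <
    \sum_i (y i + f1 (tnth s i)) ^+ 2].
  apply: (@product_measure_le _ _ _ _ _ _ B1) => //.
  + apply: measurable_real_lt; apply: measurable_sum_ord => i; apply: measurable_funX.
    by do ?apply: measurable_funD => //; apply: mt.
  + exact: ltW.
  + exact: H1.
  + move=> s /negP; rewrite -leNgt => hs; have := H2 n hn2 _ hs.
    apply: le_trans; rewrite le_eqVlt; apply/orP; left; apply/eqP.
    by congr (iid_law Q2 n _); apply/seteqP; split => t; rewrite /xsection /= in_setE.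
- move=> s /negP; rewrite -leNgt => hs; have := H3 n hn3 _ hs.
  have -> : A + K1 + dl / 3 + K2 + dl / 3 + K3 + dl / 3 = A + K1 + K2 + K3 + dl by lra.
  apply: le_trans; rewrite le_eqVlt; apply/orP; left; apply/eqP.
  by congr (iid_law Q3 n _); apply/seteqP; split => t; rewrite /xsection /= in_setE.
Qed.
End three_sources.

(** * Primes of subexponential size *)

Lemma fact_leq_exp x : (x`! <= x ^ x)%N.
Proof.
suff H m : (m <= x -> m`! <= x ^ m)%N by exact: H.
elim: m => // m IH mx; rewrite factS expnS leq_mul// IH// ltnW//.
Qed.

Lemma exists_prime_fact x : exists p, [/\ prime p, (x < p)%N & (p <= x`!.+1)%N].
Proof.
have x1 : (1 < x`!.+1)%N by rewrite ltnS fact_gt0.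
exists (pdiv x`!.+1); split; [exact: pdiv_prime| |exact: pdiv_leq].
rewrite ltnNge; apply/negP => px.
have pd : (pdiv x`!.+1 %| x`!)%N by rewrite dvdn_fact// px pdiv_gt0.
have : (pdiv x`!.+1 %| 1)%N by rewrite -(dvdn_addr _ pd) addn1 pdiv_dvd.
by rewrite dvdn1 => /eqP h; have := pdiv_prime x1; rewrite h.
Qed.

Section prime_growth.
Context {R : realType}.

(** The exponential is at least [(1 + d * x / 2) ^+ 2], hence at least [d ^+ 2 * x ^+ 2 / 4]. *)
Lemma natr_le_expR (d : R) (x : nat) : 0 < d -> 4 / d ^+ 2 <= x%:R -> x%:R <= expR (d * x%:R).
Proof.
move=> d0; rewrite ler_pdivrMr ?exprn_gt0// => hx.
have -> : d * x%:R = d * x%:R / 2 + d * x%:R / 2 by lra.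
rewrite expRD; have h := expR_ge1Dx (d * x%:R / 2).
have x0 : 0 <= x%:R :> R by [].
have dx : 0 <= d * x%:R by rewrite mulr_ge0// ltW.
apply: le_trans (ler_pM _ _ h h); [|by lra|by lra].
have := ler_wpM2l x0 hx; nra.
Qed.

(* The modulus has to exceed the diameter of the balls, of order sqrt n, while
   n p^3 has to stay below an exponential in n; Euclid's bound p <= x! + 1 with x of
   order sqrt n is good enough, so no Bertrand postulate is needed. *)
Lemma exists_prime_subexp (b L : R) : 0 < b -> 0 < L -> exists n0, forall n, (n0 <= n)%N ->
  exists p, [/\ prime p, 4 * (n%:R * b) < p%:R ^+ 2 &
    n%:R * p%:R ^+ 3 <= 8 * expR (n%:R * (L / 2))].
Proof.
move=> b0 L0.
(* With [x <= s + 1] and [s ^+ 2 = 4 * n * b], [3 * x ^+ 2 <= 6 * (s ^+ 2 + 1) <= D * n]. Then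
   [a * D = L / 4] makes [p ^+ 3] at most [8 * expR (n * L / 4)], which leaves [L / 4] for the
   factor [n]. *)
pose D : R := 24 * b + 6; have D0 : 0 < D by rewrite /D; lra.
pose a : R := L / (4 * D); have a0 : 0 < a by rewrite divr_gt0 ?mulr_gt0.
pose X : R := 4 / a ^+ 2; have X0 : 0 < X by rewrite divr_gt0 ?exprn_gt0.
(* The first summand forces [s >= X], so that [natr_le_expR] applies to [x] with [a]; the second
   lets it apply to [n] with [L / 4]. *)
exists (Num.truncn (X ^+ 2 / (4 * b) + 4 / (L / 4) ^+ 2)).+1 => n hn.
have nbig : X ^+ 2 / (4 * b) + 4 / (L / 4) ^+ 2 <= n%:R.
  by apply: ltW; apply: lt_le_trans (truncnS_gt _) _; rewrite ler_nat.
have n1 : 1 <= n%:R :> R by rewrite ler1n (leq_ltn_trans _ hn).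
have t1 : 0 <= X ^+ 2 / (4 * b) by rewrite divr_ge0 ?sqr_ge0// mulr_ge0// ltW.
have t2 : 0 <= 4 / (L / 4) ^+ 2 by rewrite divr_ge0// sqr_ge0.
pose s : R := Num.sqrt (4 * (n%:R * b)).
have s2 : s ^+ 2 = 4 * (n%:R * b) by rewrite sqr_sqrtr// !mulr_ge0// ltW.
have s0 : 0 <= s by rewrite sqrtr_ge0.
pose x := (Num.truncn s).+1.
have sx : s < x%:R by exact: truncnS_gt.
have xs : x%:R <= s + 1 by rewrite /x -natr1 lerD2r truncn_le.
have [p [pp xp px]] := exists_prime_fact x.
exists p; split=> //.
  have : x%:R < p%:R :> R by rewrite ltr_nat.
  by rewrite -s2; nra.
have Xs : X <= s.
  rewrite -(@ler_pXn2r _ 2)// ?nnegrE ?(ltW X0)// s2.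
  have : X ^+ 2 / (4 * b) <= n%:R by lra.
  by rewrite ler_pdivrMr ?mulr_gt0//; lra.
have xe : x%:R <= expR (a * x%:R).
  by apply: natr_le_expR => //; rewrite -/X; lra.
have pe : p%:R <= 2 * expR (a * x%:R ^+ 2).
  have : x`!%:R <= expR (a * x%:R ^+ 2) :> R.
    apply: (@le_trans _ _ ((x ^ x)%N%:R)); first by rewrite ler_nat fact_leq_exp.
    rewrite natrX (_ : a * x%:R ^+ 2 = x%:R * (a * x%:R)); last by ring.
    by rewrite expRM_natl lerXn2r ?nnegrE ?expR_ge0.
  have : 1 <= expR (a * x%:R ^+ 2) by rewrite -expR0 ler_expR mulr_ge0 ?sqr_ge0// ltW.
  have : p%:R <= x`!%:R + 1 :> R by rewrite natr1 ler_nat.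
  lra.
have p3 : p%:R ^+ 3 <= 8 * expR (n%:R * (L / 4)).
  apply: (@le_trans _ _ ((2 * expR (a * x%:R ^+ 2)) ^+ 3)).
    by rewrite lerXn2r ?nnegrE// mulr_ge0// expR_ge0.
  rewrite exprMn -expRM_natl (_ : 2 ^+ 3 = 8 :> R); last by ring.
  rewrite ler_pM2l// ler_expR.
  have x2 : x%:R ^+ 2 * 3 <= D * n%:R.
    have : x%:R ^+ 2 <= (s + 1) ^+ 2 by rewrite lerXn2r ?nnegrE// addr_ge0.
    have : 0 <= (s - 1) ^+ 2 by rewrite sqr_ge0.
    by rewrite /D; have := s2; lra.
  rewrite (_ : L / 4 = a * D); last by rewrite /a; field; rewrite gt_eqF.
  have := ler_wpM2l (ltW a0) x2; lra.
have ne : n%:R <= expR (n%:R * (L / 4)).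
  rewrite mulrC; apply: natr_le_expR; last by lra.
  by rewrite divr_gt0.
rewrite (_ : n%:R * (L / 2) = n%:R * (L / 4) + n%:R * (L / 4)); last by lra.
by rewrite expRD [leRHS]mulrCA ler_pM// exprn_ge0.
Qed.
End prime_growth.

(** * The lattice code *)

Section finite_fibres.

(** Residues and messages live in finite types without a chosen sigma-algebra, so measurability of a
    map into them is stated on its fibres. For a finite target this makes every preimage
    measurable. *)
Definition measurable_fibres d (X : measurableType d) (I : Type) (psi : X -> I) :=
  forall i, measurable (psi @^-1` [set i]).

Lemma measurable_fibres_preimage d (X : measurableType d) (I : finType) (psi : X -> I)
  (S : set I) : measurable_fibres psi -> measurable (psi @^-1` S).
Proof.
move=> mpsi.
have -> : psi @^-1` S = \bigcup_(i in S) (psi @^-1` [set i]).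
  by apply/seteqP; split => [x Sx|x [i Si] /= ->//]; exists (psi x).
by apply: fin_bigcup_measurable => //; exact: finite_finset.
Qed.

Lemma measurable_fibres_comp d (X : measurableType d) (I : finType) (J : Type)
  (psi : X -> I) (f : I -> J) :
  measurable_fibres psi -> measurable_fibres (f \o psi).
Proof.
move=> mpsi j; rewrite comp_preimage; exact: measurable_fibres_preimage.
Qed.

Lemma measurable_fibres_pair d1 d2 (X1 : measurableType d1) (X2 : measurableType d2)
  (I1 I2 : Type) (psi1 : X1 -> I1) (psi2 : X2 -> I2) :
  measurable_fibres psi1 -> measurable_fibres psi2 ->
  measurable_fibres (fun x : X1 * X2 => (psi1 x.1, psi2 x.2)).
Proof.
move=> m1 m2 [i1 i2].
rewrite (_ : _ @^-1` _ = (psi1 @^-1` [set i1]) `*` (psi2 @^-1` [set i2])).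
  exact: measurableX.
by apply/seteqP; split => -[x1 x2] /= [-> ->].
Qed.

Lemma measurable_fibres_fun d (X : measurableType d) d' (Y : measurableType d')
  (I : finType) (psi : X -> I) (f : I -> Y) :
  measurable_fibres psi -> measurable_fun setT (f \o psi).
Proof.
move=> mpsi _ A mA; rewrite setTI comp_preimage; exact: measurable_fibres_preimage.
Qed.

End finite_fibres.

Section discrete_type.
Variable V : finZmodType.

(** A copy of [V] in which every set is measurable, so that residues can serve as dithers. *)
Definition discrete : Type := V.

HB.instance Definition _ := Choice.on discrete.
HB.instance Definition _ := isPointed.Build discrete (0 : V).
HB.instance Definition _ := @isMeasurable.Build default_measure_display
  discrete discrete_measurable discrete_measurable0
  discrete_measurableC discrete_measurableU.

Context {R : realType}.

Lemma card_inv_ge0 : 0 <= #|V|%:R^-1 :> R.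
Proof. by rewrite invr_ge0. Qed.

Definition unif_law : set discrete -> \bar R :=
  mscale (NngNum card_inv_ge0) (msum (fun i => \d_(nth 0 (enum V) i : discrete)) #|V|).

HB.instance Definition _ := Measure.on unif_law.

Lemma unif_lawE (S : set discrete) :
  unif_law S = ((#|V|%:R^-1) * \sum_(x : V) (x \in S)%:R)%:E.
Proof.
rewrite /unif_law /mscale /= /msum EFinM; congr (_ * _)%E.
rewrite -sumEFin -[RHS]big_enum /= (big_nth 0) -cardE big_mkord; apply: eq_bigr => i _.
by rewrite diracE.
Qed.

Lemma card_zmod_gt0 : (0 < #|V|)%N.
Proof. by apply/card_gt0P; exists 0. Qed.

Lemma unif_lawT : unif_law setT = 1%E.
Proof.
rewrite unif_lawE (_ : \sum_(x : V) _ = #|V|%:R).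
  by rewrite mulVf// pnatr_eq0 -lt0n card_zmod_gt0.
by rewrite -sum1_card natr_sum; apply: eq_bigr => x _; rewrite in_setT.
Qed.

HB.instance Definition _ := Measure_isProbability.Build _ _ _ unif_law unif_lawT.

Lemma unif_law1 (x : V) : unif_law [set x] = (#|V|%:R^-1)%:E.
Proof.
rewrite unif_lawE (bigD1 x)//= big1 ?addr0 ?mem_set ?mulr1//.
by move=> y /eqP yx; rewrite memNset.
Qed.

End discrete_type.

Section quantizer.
Context {R : realType} (p n : nat).

Definition quantize (gam mu : R) (y : n.-tuple R) : 'rV['F_p]_n :=
  \row_i (Num.floor (gam * (tnth y i - mu)))%:~R.

Lemma measurable_fibres_quantize gam mu : measurable_fibres (quantize gam mu).
Proof.
move=> g.
pose A i := [set x : R | (Num.floor (gam * (x - mu)))%:~R = g 0 i].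
have mA i : measurable (A i).
  have -> : A i = \bigcup_(z in [set z : int | z%:~R = g 0 i])
      ([set x | z%:~R <= gam * (x - mu)] `\` [set x | (z + 1)%:~R <= gam * (x - mu)]).
    apply/seteqP; split => x.
      move=> Ax; exists (Num.floor (gam * (x - mu))) => //=.
      have /andP[-> h] := floor_itv (gam * (x - mu)).
      by split=> //; apply/negP; rewrite -ltNge.
    move=> [z /= zg [z1 /negP]]; rewrite -ltNge => z2; rewrite /A /=.
    by have -> : Num.floor (gam * (x - mu)) = z by apply: floor_def; rewrite z1.
  have mf : measurable_fun setT (fun x : R => gam * (x - mu)).
    by apply: measurable_funM => //; exact: measurable_funB.
  rewrite bigcup_mkcond; apply: countable_bigcupT_measurable => // z.
  by case: ifP => // _; apply: measurableD; exact: measurable_real_le.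
have -> : quantize gam mu @^-1` [set g] =
    \bigcap_(i in [set: 'I_n]) ((@tnth n R)^~ i @^-1` A i).
  apply/seteqP; split => y /=.
    by move=> yg i _; rewrite /A /= -yg mxE.
  by move=> h; apply/rowP => i; rewrite mxE; exact: (h i I).
apply: fin_bigcap_measurable => // i _.
by rewrite -[_ @^-1` _]setTI; exact: measurable_tnth.
Qed.

End quantizer.
Arguments unif_law V {R} _.

Lemma measurable_fibres_pairT d (X : measurableType d) (I1 I2 : Type)
  (psi1 : X -> I1) (psi2 : X -> I2) :
  measurable_fibres psi1 -> measurable_fibres psi2 ->
  measurable_fibres (fun x => (psi1 x, psi2 x)).
Proof.
move=> m1 m2 [i1 i2].
rewrite (_ : _ @^-1` _ = (psi1 @^-1` [set i1]) `&` (psi2 @^-1` [set i2])).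
  exact: measurableI.
by apply/seteqP; split => x /= [-> ->].
Qed.

Lemma measurable_fibres_mfun d (X : measurableType d) d' (Y : measurableType d')
  (I : Type) (g : X -> Y) (psi : Y -> I) :
  measurable_fun setT g -> measurable_fibres psi -> measurable_fibres (psi \o g).
Proof.
move=> mg mpsi i; rewrite comp_preimage -[_ @^-1` _]setTI.
exact: mg.
Qed.

Section uniform_sections.
Context {R : realType} {d : measure_display} {X : measurableType d} (V : finZmodType).
Variable P : probability X R.

(** For each [x] the uniform variable hits the single point [g x] with the same probability. This is
    the source of the independence between residues and side information. *)
Lemma unif_graph (A : set X) (g : X -> V) : measurable A ->
  ((P \x (unif_law V : set _ -> \bar R)) [set x | A x.1 /\ x.2 = g x.1] =
    P A * (#|V|%:R^-1)%:E)%E.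
Proof.
move=> mA; rewrite /product_measure1.
transitivity (\int[P]_x ((\1_A x)%:E * (#|V|%:R^-1)%:E))%E.
  apply: eq_integral => x _ /=; rewrite indicE.
  have [xA|xA] := boolP (x \in A).
    rewrite mul1e -(unif_law1 (g x)); congr (unif_law V _).
    move: xA; rewrite in_setE => Ax.
    by apply/seteqP; split => y; rewrite /xsection /= in_setE; [case|].
  rewrite mul0e (_ : xsection _ _ = set0) ?measure0//.
  apply/seteqP; split => y; rewrite /xsection /= in_setE// => -[Ax _].
  by move: xA; rewrite mem_set.
rewrite ge0_integralZr//; last by apply/measurable_EFinP; exact: measurable_indic.
by rewrite integral_indic// setIT.
Qed.

End uniform_sections.

Section finite_measure_sums.
Context d (X : measurableType d) (R : realType) (I : finType).
Variable mu : {measure set X -> \bar R}.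

Lemma measure_finite_cover (F : I -> set X) (A : set X) : measurable A ->
  (forall i, measurable (F i)) -> (forall x, A x -> exists i, F i x) ->
  (mu A <= \sum_i mu (F i))%E.
Proof.
move=> mA mF AF.
have mU (s : seq I) : measurable (\big[setU/set0]_(i <- s) F i).
  exact: bigsetU_measurable.
apply: (@le_trans _ _ (mu (\big[setU/set0]_(i <- index_enum I) F i))).
  apply: le_measure; rewrite ?inE// => x /AF[i Fi].
  by rewrite -bigcup_seq; exists i => //=; rewrite mem_index_enum.
elim: (index_enum I) => [|i s IH]; first by rewrite !big_nil measure0.
by rewrite !big_cons; apply: le_trans (measureU2 _ (mF i) (mU s)) _; rewrite leeD2l.
Qed.

Lemma integral_fibres (psi : X -> I) (g : I -> R) : measurable_fibres psi ->
  (forall i, 0 <= g i) ->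
  (\int[mu]_x (g (psi x))%:E = \sum_i (g i)%:E * mu (psi @^-1` [set i]))%E.
Proof.
move=> mpsi g0.
transitivity (\int[mu]_x (\sum_i (g i)%:E * (\1_(psi @^-1` [set i]) x)%:E))%E.
  apply: eq_integral => x _; rewrite (bigD1 (psi x))//= big1 ?adde0.
    by rewrite indicE mem_set// mule1.
  by move=> i ix; rewrite indicE memNset ?mule0// => /esym/eqP; rewrite (negbTE ix).
rewrite ge0_integral_sum//; last 2 first.
- by move=> i; apply: emeasurable_funM => //; apply/measurable_EFinP; exact: measurable_indic.
- by move=> i x _; rewrite mule_ge0 ?lee_fin.
apply: eq_bigr => i _; rewrite ge0_integralZl ?lee_fin//.
- by rewrite integral_indic// setIT.
- by apply/measurable_EFinP; exact: measurable_indic.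
Qed.

End finite_measure_sums.

Section construction.
Context {R : realType}.
Variables (n p k M1 M2 : nat).
Notation V := 'rV['F_p]_n.
Variables (G : 'M['F_p]_(k, n)) (b2 t2 gam be1 be2 mu : R).
Variable w0 : 'I_M1 * 'I_M2.
Variable v : ({ffun 'I_M1 -> V} * {ffun 'I_M2 -> V})%type.

(* Balls and noises are measured in grid steps, channel inputs are not: with the
   grid step a and the coefficients alpha, beta_i of the header, gam = alpha / a and
   be_i = a beta_i.  The noise and the estimation errors need not be centered:
   mu is the sum of their means. *)
Definition coset_rep (h : V) : V :=
  if [pick u | grid_ball b2 (h + u *m G)] is Some u then h + u *m G else h.

Lemma coset_repE h : exists u, coset_rep h = h + u *m G.
Proof.
rewrite /coset_rep; case: pickP => [u _|_]; first by exists u.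
by exists 0; rewrite mul0mx addr0.
Qed.

Lemma coset_rep_ball h : ~~ [forall u, ~~ grid_ball b2 (h + u *m G)] -> grid_ball b2 (coset_rep h).
Proof.
rewrite /coset_rep; case: pickP => [u //|hN /negP[]].
by apply/forallP => u; rewrite hN.
Qed.

Definition scaled_rep (be : R) (h : V) : n.-tuple R :=
  [tuple be * lift_coord (coset_rep h) i | i < n].

Definition lattice_enc (be : R) (c : V) (x : n.-tuple R * discrete V) : n.-tuple R :=
  scaled_rep be (c - quantize p gam 0 x.1 - x.2).

(** Adding the dithers undoes their subtraction by the encoders. The choice among several admissible
    pairs is arbitrary, since the analysis counts any admissible wrong pair as an error; [w0] is the
    answer when no pair is admissible. *)
Definition lattice_dec (x : n.-tuple R * discrete V * discrete V) : 'I_M1 * 'I_M2 :=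
  let ybar : V := quantize p gam mu x.1.1 + x.1.2 + x.2 in
  odflt w0 [pick w | [exists u, grid_ball t2 (ybar - codesum v w - u *m G)]].

Lemma measurable_fibres_discrete (T : finZmodType) :
  measurable_fibres (fun x : discrete T => x : T).
Proof. by move=> i. Qed.

Lemma measurable_lattice_enc be c : measurable_fun setT (lattice_enc be c).
Proof.
pose psi (x : n.-tuple R * discrete V) : (V * V)%type := (quantize p gam 0 x.1, (x.2 : V)).
apply: (@measurable_fibres_fun _ _ _ _ (V * V)%type psi
  (fun y => scaled_rep be (c - y.1 - y.2))).
exact: (measurable_fibres_pair (measurable_fibres_quantize _ _) (@measurable_fibres_discrete V)).
Qed.

Lemma measurable_lattice_dec m : measurable (lattice_dec @^-1` [set m]).
Proof.
pose psi (x : n.-tuple R * discrete V * discrete V) : (V * V * V)%type :=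
  ((quantize p gam mu x.1.1, (x.1.2 : V)), (x.2 : V)).
apply: (@measurable_fibres_comp _ _ (V * V * V)%type _ psi
  (fun y => odflt w0 [pick w | [exists u, grid_ball t2 (y.1.1 + y.1.2 + y.2 - codesum v w - u *m G)]])).
exact: (measurable_fibres_pair (measurable_fibres_pair
  (measurable_fibres_quantize _ _) (@measurable_fibres_discrete V)) (@measurable_fibres_discrete V)).
Qed.

Definition lattice_code : Defs.code R n M1 M2 :=
  @Defs.Code R n M1 M2 _ _ (discrete V) (discrete V) (unif_law V) (unif_law V)
    (fun w => lattice_enc be1 (v.1 w)) (fun w => lattice_enc be2 (v.2 w)) lattice_dec
    (fun w => measurable_lattice_enc be1 (v.1 w)) (fun w => measurable_lattice_enc be2 (v.2 w))
    measurable_lattice_dec.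

End construction.

(** * Error probability and power of the lattice code *)

Section analysis.
Context {R : realType}.
Variables (n p k M1 M2 : nat).
Notation V := 'rV['F_p]_n.
Notation S3 := (n.-tuple (R * R) * n.-tuple (R * R) * n.-tuple R)%type.
Variables (G : 'M['F_p]_(k, n)) (b2 t2 gam be1 be2 mu : R).
Variable w0 : 'I_M1 * 'I_M2.
Hypothesis pp : prime p.

Notation est1 s := (map_tuple snd s.1.1).
Notation est2 s := (map_tuple snd s.1.2).

Definition chan_out (h1 h2 : V) (s : S3) : n.-tuple R :=
  vadd (vadd (vadd (vadd (scaled_rep G b2 be1 h1) (scaled_rep G b2 be2 h2))
    (map_tuple fst s.1.1)) (map_tuple fst s.1.2)) s.2.

(* What the decoder sees modulo the lattice once the codewords are removed.  It
   depends on the codebooks, the messages and the dithers only through the residues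
   h1 and h2, which the dithers make uniform and independent of s. *)
Definition eff_noise (h1 h2 : V) (s : S3) : V :=
  quantize p gam mu (chan_out h1 h2 s) - quantize p gam 0 (est1 s) - quantize p gam 0 (est2 s)
    - coset_rep G b2 h1 - coset_rep G b2 h2.

(** The real noise before rounding. The first line is the self noise, since [gam * be_i] is
    [alpha * beta_i]; of each interference only the estimation error survives. *)
Definition residual_noise (h1 h2 : V) (s : S3) (i : 'I_n) : R :=
  (gam * be1 - 1) * lift_coord (coset_rep G b2 h1) i + (gam * be2 - 1) * lift_coord (coset_rep G b2 h2) i
  + gam * (((tnth s.1.1 i).1 - (tnth s.1.1 i).2)
    + ((tnth s.1.2 i).1 - (tnth s.1.2 i).2) + tnth s.2 i - mu).

Definition frac_part (x : R) : R := x - (Num.floor x)%:~R.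

Lemma frac_part_itv x : 0 <= frac_part x < 1.
Proof.
by have := floor_itv x; rewrite intrD /frac_part subr_ge0 ltrBlDl.
Qed.

(** The scaled output is an integer, made of two lifts and two floors, plus the residual noise and
    two fractional parts. The integer comes out of the floor and cancels modulo [p] against what
    [eff_noise] subtracts. *)
Lemma eff_noiseE h1 h2 s : eff_noise h1 h2 s = \row_i (Num.floor (residual_noise h1 h2 s i
  + frac_part (gam * (tnth s.1.1 i).2) + frac_part (gam * (tnth s.1.2 i).2)))%:~R.
Proof.
apply/rowP => i; rewrite !mxE !(tnth_map snd) !subr0.
set f1 := Num.floor (gam * (tnth s.1.1 i).2); set f2 := Num.floor (gam * (tnth s.1.2 i).2).
set r1 := coset_rep G b2 h1 0 i; set r2 := coset_rep G b2 h2 0 i.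
have -> : gam * (tnth (chan_out h1 h2 s) i - mu) =
  (centered_lift r1 + centered_lift r2 + f1 + f2)%:~R + (residual_noise h1 h2 s i
  + frac_part (gam * (tnth s.1.1 i).2) + frac_part (gam * (tnth s.1.2 i).2)).
  rewrite !tnth_mktuple !tnth_map /residual_noise /frac_part -/f1 -/f2 /lift_coord -/r1 -/r2 !intrD.
  by ring.
rewrite floorDzr ?intr_int// intrKfloor !intrD !centered_liftK//.
by ring.
Qed.

Variable v : ({ffun 'I_M1 -> V} * {ffun 'I_M2 -> V})%type.

Definition collides (w : 'I_M1 * 'I_M2) (tau : V) : bool :=
  [exists w', (w' != w) && [exists u : 'rV['F_p]_k,
    grid_ball t2 (codesum v w - codesum v w' + tau - u *m G)]].

(** A representative differs from its residue by a lattice point, so the decoder works on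
    [codesum v w] plus [eff_noise] plus a lattice point: estimates and dithers have cancelled. *)
Lemma lattice_dec_correct w h1 h2 s (d1 d2 : V) :
  h1 = v.1 w.1 - quantize p gam 0 (est1 s) - d1 ->
  h2 = v.2 w.2 - quantize p gam 0 (est2 s) - d2 ->
  grid_ball t2 (eff_noise h1 h2 s) -> ~~ collides w (eff_noise h1 h2 s) ->
  lattice_dec G t2 gam mu w0 v (chan_out h1 h2 s, d1, d2) = w.
Proof.
move=> h1E h2E zb nc; rewrite /lattice_dec /=.
set yb := _ + d1 + d2.
have [u1 l1] := coset_repE G b2 h1; have [u2 l2] := coset_repE G b2 h2.
have ybE : yb = codesum v w + eff_noise h1 h2 s + (u1 + u2) *m G.
  have d1E : d1 = v.1 w.1 - quantize p gam 0 (est1 s) - h1 by rewrite h1E subKr.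
  have d2E : d2 = v.2 w.2 - quantize p gam 0 (est2 s) - h2 by rewrite h2E subKr.
  rewrite /eff_noise l1 l2 /codesum /yb d1E d2E mulmxDl.
  move: (quantize _ _ _ _) (quantize _ _ _ _) (quantize _ _ _ _) => q q1 q2.
  by apply/rowP => i; rewrite !mxE; ring.
case: pickP => [w' /existsP[u uB]|/(_ w)/existsP[]] /=; last first.
  exists (u1 + u2); rewrite ybE.
  by rewrite (_ : _ - _ = eff_noise h1 h2 s)//; apply/rowP => i; rewrite !mxE; ring.
apply/eqP/negPn/negP => w'w; move/negP: nc; apply; apply/existsP; exists w'.
rewrite w'w; apply/existsP; exists (u - u1 - u2).
rewrite (_ : _ - _ = yb - codesum v w' - u *m G)// ybE.
rewrite !mulmxBl mulmxDl.
by apply/rowP => i; rewrite !mxE; ring.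
Qed.

End analysis.

Lemma measurable_vadd d (X : measurableType d) (R : realType) n (f g : X -> n.-tuple R) :
  measurable_fun setT f -> measurable_fun setT g ->
  measurable_fun setT (fun x => vadd (f x) (g x)).
Proof.
move=> mf mg; apply/measurable_fun_tnthP => i.
rewrite (_ : _ \o _ = (fun x => tnth (f x) i + tnth (g x) i)); last first.
  by apply/funext => x /=; rewrite tnth_mktuple.
by apply: measurable_funD; [exact: (measurableT_comp (measurable_tnth i) mf)|
  exact: (measurableT_comp (measurable_tnth i) mg)].
Qed.

Lemma measurable_map_tuple d (X : measurableType d) d' (Y : measurableType d') n (f : X -> Y) :
  measurable_fun setT f -> measurable_fun setT (fun s : n.-tuple X => map_tuple f s).
Proof.
move=> mf; apply/measurable_fun_tnthP => i.
rewrite (_ : _ \o _ = (fun s => f (tnth s i))); last first.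
  by apply/funext => x /=; rewrite tnth_map.
exact: (measurableT_comp mf (measurable_tnth i)).
Qed.

Section decoded_measurable.
Context {R : realType} {n M1 M2 : nat} (c : Defs.code R n M1 M2).

Lemma measurable_decoded_neq (w : 'I_M1 * 'I_M2) : measurable [set o : outcome c | decoded w o <> w].
Proof.
pose O := (n.-tuple (R * R) * n.-tuple (R * R) * n.-tuple R * dither1 c * dither2 c)%type.
have m1 : measurable_fun setT (fun o : O => o.1) by exact: measurable_fst.
have m11 : measurable_fun setT (fun o : O => o.1.1) by exact: (measurableT_comp measurable_fst m1).
have m111 : measurable_fun setT (fun o : O => o.1.1.1) by exact: (measurableT_comp measurable_fst m11).
have ms1 : measurable_fun setT (fun o : O => o.1.1.1.1) by exact: (measurableT_comp measurable_fst m111).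
have ms2 : measurable_fun setT (fun o : O => o.1.1.1.2) by exact: (measurableT_comp measurable_snd m111).
have mz : measurable_fun setT (fun o : O => o.1.1.2) by exact: (measurableT_comp measurable_snd m11).
have md1 : measurable_fun setT (fun o : O => o.1.2) by exact: (measurableT_comp measurable_snd m1).
have md2 : measurable_fun setT (fun o : O => o.2) by exact: measurable_snd.
have mmap (f : R * R -> R) (g : O -> n.-tuple (R * R)) : measurable_fun setT f ->
    measurable_fun setT g -> measurable_fun setT (fun o => map_tuple f (g o)).
  by move=> mf mg; exact: (measurableT_comp (measurable_map_tuple mf) mg).
have mi1 : measurable_fun setT (fun o : O => enc1 w.1 (map_tuple snd o.1.1.1.1, o.1.2)).
  exact: (measurableT_comp (@measurable_enc1 _ _ _ _ c w.1)
    (measurable_fun_pair (mmap _ _ measurable_snd ms1) md1)).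
have mi2 : measurable_fun setT (fun o : O => enc2 w.2 (map_tuple snd o.1.1.1.2, o.2)).
  exact: (measurableT_comp (@measurable_enc2 _ _ _ _ c w.2)
    (measurable_fun_pair (mmap _ _ measurable_snd ms2) md2)).
have mdec : measurable_fun setT (fun o : O => ((vadd (vadd (vadd (vadd
    (enc1 w.1 (map_tuple snd o.1.1.1.1, o.1.2)) (enc2 w.2 (map_tuple snd o.1.1.1.2, o.2)))
    (map_tuple fst o.1.1.1.1)) (map_tuple fst o.1.1.1.2)) o.1.1.2, o.1.2), o.2)).
  apply: measurable_fun_pair => //; apply: measurable_fun_pair => //.
  by do ?apply: measurable_vadd => //; exact: mmap.
have := mdec measurableT _ (measurableC (@measurable_dec _ _ _ _ c w)).
by rewrite setTI.
Qed.
End decoded_measurable.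

Section bounds.
Context {R : realType}.
Variables (N : R) (Q1 Q2 : probability (R * R)%type R).
Variables (n p k M1 M2 : nat).
Notation V := 'rV['F_p]_n.
Notation S3 := (n.-tuple (R * R) * n.-tuple (R * R) * n.-tuple R)%type.
Notation books := ({ffun 'I_M1 -> V} * {ffun 'I_M2 -> V})%type.
Variables (G : 'M['F_p]_(k, n)) (b2 t2 gam be1 be2 mu : R).
Variable w0 : 'I_M1 * 'I_M2.

Notation est1 s := (map_tuple snd s.1.1).
Notation est2 s := (map_tuple snd s.1.2).
Notation eff_noise := (eff_noise G b2 gam be1 be2 mu).
Notation cd := (lattice_code G b2 t2 gam be1 be2 mu w0).

Definition side_law : set S3 -> \bar R :=
  (iid_law Q1 n \x iid_law Q2 n \x iid_law (noise_law N) n)%E.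

HB.instance Definition _ := Probability.on side_law.

Lemma measurable_est1 : measurable_fun setT (fun s : S3 => est1 s).
Proof.
apply: (measurableT_comp (measurable_map_tuple measurable_snd)).
exact: measurableT_comp.
Qed.

Lemma measurable_est2 : measurable_fun setT (fun s : S3 => est2 s).
Proof.
apply: (measurableT_comp (measurable_map_tuple measurable_snd)).
exact: measurableT_comp.
Qed.

Lemma measurable_fibres_eff_noise h1 h2 : measurable_fibres (eff_noise h1 h2).
Proof.
have mout : measurable_fun setT (chan_out G b2 be1 be2 h1 h2).
  apply: measurable_vadd; last exact: measurable_snd.
  apply: measurable_vadd.
    apply: measurable_vadd => //.
    apply: (measurableT_comp (measurable_map_tuple measurable_fst)).
    exact: measurableT_comp.
  apply: (measurableT_comp (measurable_map_tuple measurable_fst)).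
  exact: measurableT_comp.
pose psi (s : S3) : (V * V * V)%type := (quantize p gam mu (chan_out G b2 be1 be2 h1 h2 s),
  quantize p gam 0 (est1 s), quantize p gam 0 (est2 s)).
apply: (@measurable_fibres_comp _ _ (V * V * V)%type _ psi
  (fun y => y.1.1 - y.1.2 - y.2 - coset_rep G b2 h1 - coset_rep G b2 h2)).
apply: measurable_fibres_pairT; first apply: measurable_fibres_pairT.
- exact: (measurable_fibres_mfun mout (@measurable_fibres_quantize R p n gam mu)).
- exact: (measurable_fibres_mfun measurable_est1 (@measurable_fibres_quantize R p n gam 0)).
- exact: (measurable_fibres_mfun measurable_est2 (@measurable_fibres_quantize R p n gam 0)).
Qed.

Variable v : books.

Definition residue1 w1 (o : outcome (cd v)) : V := v.1 w1 - quantize p gam 0 (est1 o.1.1) - o.1.2.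
Definition residue2 w2 (o : outcome (cd v)) : V := v.2 w2 - quantize p gam 0 (est2 o.1.1) - o.2.

Notation law := (outcome_law N Q1 Q2 (c := cd v)).

(** A one-time pad: given the side information and the noise, each pair of residues corresponds to
    exactly one pair of dithers. [unif_graph] is applied once for each dither. *)
Lemma law_residues (A : set S3) w1 w2 h1 h2 : measurable A ->
  measurable [set o : outcome (cd v) | [/\ A o.1.1, residue1 w1 o = h1 & residue2 w2 o = h2]] /\
  law [set o | [/\ A o.1.1, residue1 w1 o = h1 & residue2 w2 o = h2]] =
    (side_law A * (#|V|%:R^-1 * #|V|%:R^-1)%:E)%E.
Proof.
move=> mA.
pose g1 (s : S3) : V := v.1 w1 - quantize p gam 0 (est1 s) - h1.
pose g2 (x : S3 * discrete V) : V := v.2 w2 - quantize p gam 0 (est2 x.1) - h2.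
pose A' : set (S3 * discrete V) := [set x | A x.1 /\ x.2 = g1 x.1].
have mg1 : measurable_fibres g1.
  apply: (@measurable_fibres_comp _ _ V _ (fun s => quantize p gam 0 (est1 s)) (fun q => v.1 w1 - q - h1)).
  exact: (measurable_fibres_mfun measurable_est1 (@measurable_fibres_quantize R p n gam 0)).
have mg2' : measurable_fibres (fun s : S3 => v.2 w2 - quantize p gam 0 (est2 s) - h2).
  apply: (@measurable_fibres_comp _ _ V _ (fun s => quantize p gam 0 (est2 s)) (fun q => v.2 w2 - q - h2)).
  exact: (measurable_fibres_mfun measurable_est2 (@measurable_fibres_quantize R p n gam 0)).
have mg2 : measurable_fibres g2.
  by move=> i; exact: (measurable_fibres_mfun measurable_fst mg2').
have mA' : measurable A'.
  rewrite (_ : A' = (A `*` setT) `&` ((fun x : S3 * discrete V => (g1 x.1, (x.2 : V))) @^-1` [set q | q.2 = q.1])).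
    apply: measurableI; first exact: measurableX.
    apply: (@measurable_fibres_preimage _ _ (V * V)%type).
        exact: (measurable_fibres_pair mg1 (@measurable_fibres_discrete V)).
  by apply/seteqP; split => x /= [] => [? ?|[] ? ? ?]; repeat split.
have swap (a q h d : V) : a - q - d = h <-> d = a - q - h.
  by split=> [<-|->]; rewrite subKr.
have sE : [set o : outcome (cd v) | [/\ A o.1.1, residue1 w1 o = h1 & residue2 w2 o = h2]] =
    [set x : S3 * discrete V * discrete V | A' x.1 /\ x.2 = g2 x.1].
  apply/seteqP; split => -[[s d1] d2]; rewrite /residue1 /residue2 /A' /g1 /g2 /=.
    by move=> [? /swap ? /swap ?].
  by move=> [[? ?] ?]; split=> //; apply/swap.
split.
  rewrite sE (_ : [set x | _] = (A' `*` setT) `&` ((fun x : S3 * discrete V * discrete V => (g2 x.1, (x.2 : V))) @^-1` [set q | q.2 = q.1])).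
    apply: measurableI; first exact: measurableX.
    apply: (@measurable_fibres_preimage _ _ (V * V)%type).
    exact: (measurable_fibres_pair mg2 (@measurable_fibres_discrete V)).
  apply/seteqP; split => x; rewrite /=. by case. by case=> -[].

have E1 := @unif_graph R _ _ V (side_law \x (unif_law V : set _ -> \bar R))%E A' g2 mA'.
have E2 := @unif_graph R _ _ V side_law A g1 mA.
rewrite sE; transitivity ((side_law \x (unif_law V : set _ -> \bar R))%E A' * (#|V|%:R^-1)%:E)%E.
  exact: E1.
by rewrite E2 -muleA -EFinM.
Qed.
End bounds.

Section error_bound.
Context {R : realType}.
Variables (N : R) (Q1 Q2 : probability (R * R)%type R).
Variables (n p k M1 M2 : nat).
Notation V := 'rV['F_p]_n.
Notation S3 := (n.-tuple (R * R) * n.-tuple (R * R) * n.-tuple R)%type.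
Notation books := ({ffun 'I_M1 -> V} * {ffun 'I_M2 -> V})%type.
Variables (G : 'M['F_p]_(k, n)) (b2 t2 gam be1 be2 m1 m2 m3 : R).
Variable w0 : 'I_M1 * 'I_M2.
Hypothesis pp : prime p.
Notation mu := (m1 + m2 + m3).
Notation eff_noise := (eff_noise G b2 gam be1 be2 mu).
Notation cd := (lattice_code G b2 t2 gam be1 be2 mu w0).
Notation P3 := (@side_law R N Q1 Q2 n).
Notation collides := (collides G t2).

Definition uncovered (h : V) := [forall u : 'rV['F_p]_k, ~~ grid_ball b2 (h + u *m G)].

Variables (om2 eps eta : R).
Hypothesis eps0 : 0 <= eps.
Hypothesis eta0 : 0 < eta.
Hypothesis hom : (1 + eta) * om2 + (1 + eta^-1) * 2 ^+ 2 <= t2.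
(* At most one of the two users leaves self noise. *)
Hypothesis hc : (gam * be1 - 1) * (gam * be2 - 1) = 0.
Hypothesis hnoise : forall y : 'I_n -> R,
  \sum_i y i ^+ 2 <= n%:R * (((gam * be1 - 1) ^+ 2 + (gam * be2 - 1) ^+ 2) * b2) ->
  (P3 [set s | (n%:R * om2 < \sum_i (y i + gam * ((tnth s.1.1 i).1 - (tnth s.1.1 i).2 - m1)
    + gam * ((tnth s.1.2 i).1 - (tnth s.1.2 i).2 - m2) + gam * (tnth s.2 i - m3)) ^+ 2)%R]
   <= eps%:E)%E.

Lemma measurable_noise_event (y : 'I_n -> R) : measurable
  [set s : S3 | n%:R * om2 < \sum_i (y i + gam * ((tnth s.1.1 i).1 - (tnth s.1.1 i).2 - m1)
    + gam * ((tnth s.1.2 i).1 - (tnth s.1.2 i).2 - m2) + gam * (tnth s.2 i - m3)) ^+ 2].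
Proof.
apply: measurable_real_lt; apply: measurable_sum_ord => i; apply: measurable_funX.
have m11 : measurable_fun setT (fun s : S3 => tnth s.1.1 i).
  exact: (measurableT_comp (measurable_tnth i) (measurableT_comp measurable_fst measurable_fst)).
have m12 : measurable_fun setT (fun s : S3 => tnth s.1.2 i).
  exact: (measurableT_comp (measurable_tnth i) (measurableT_comp measurable_snd measurable_fst)).
have m2' : measurable_fun setT (fun s : S3 => tnth s.2 i).
  exact: (measurableT_comp (measurable_tnth i) measurable_snd).
have ma := measurableT_comp measurable_fst m11; have mb := measurableT_comp measurable_snd m11.
have mc := measurableT_comp measurable_fst m12; have md := measurableT_comp measurable_snd m12.
apply: measurable_funD; last by apply: measurable_funM => //; exact: measurable_funB.
apply: measurable_funD; last first.
  by apply: measurable_funM => //; apply: measurable_funB => //; exact: measurable_funB.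
apply: measurable_funD => //.
by apply: measurable_funM => //; apply: measurable_funB => //; exact: measurable_funB.
Qed.

Lemma eff_noise_outside_le h1 h2 : ~~ uncovered h1 -> ~~ uncovered h2 ->
  (P3 (eff_noise h1 h2 @^-1` [set tau | ~~ grid_ball t2 tau]) <= eps%:E)%E.
Proof.
move=> /coset_rep_ball c1 /coset_rep_ball c2.
pose y i : R := (gam * be1 - 1) * lift_coord (coset_rep G b2 h1) i + (gam * be2 - 1) * lift_coord (coset_rep G b2 h2) i.
have hy : \sum_i y i ^+ 2 <= n%:R * (((gam * be1 - 1) ^+ 2 + (gam * be2 - 1) ^+ 2) * b2).
  move: c1 c2 (hc) => c1 c2; rewrite /grid_ball in c1 c2.
  rewrite /y; move: (gam * be1 - 1) (gam * be2 - 1) => a b ab0.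
  have -> : \sum_i (a * lift_coord (coset_rep G b2 h1) i + b * lift_coord (coset_rep G b2 h2) i) ^+ 2 = a ^+ 2 * \sum_i lift_coord (coset_rep G b2 h1) i ^+ 2
      + b ^+ 2 * \sum_i lift_coord (coset_rep G b2 h2) i ^+ 2.
    rewrite !mulr_sumr -big_split /=; apply: eq_bigr => i _.
    (* By [hc] one of the two self noises has coefficient 0, so there is no cross term. *)
    rewrite sqrrD (_ : _ *+ 2 = 0) ?addr0 ?exprMn//.
    by rewrite mulrACA ab0 mul0r mul0rn.
  have := ler_wpM2l (sqr_ge0 a) c1; have := ler_wpM2l (sqr_ge0 b) c2; lra.
apply: le_trans (hnoise hy); apply: le_measure; rewrite ?inE.
- exact: (measurable_fibres_preimage _ (measurable_fibres_eff_noise _ _ _ _ _ _ _ _)).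
- exact: measurable_noise_event.
move=> s /=; apply: contraNP => /negP; rewrite -leNgt => hs.
rewrite eff_noiseE//; apply: grid_ball_cast => //.
apply: (@le_trans _ _ (n%:R * ((1 + eta) * om2 + (1 + eta^-1) * 2 ^+ 2))); last first.
  by rewrite ler_wpM2l.
(* The two fractional parts lie in [[0, 1)] and the floor loses less than 1, so each coordinate
   moves by an amount between -1 and 2; hence the constant 2 in [hom]. *)
apply: (sum_sqr_add_le eta0 _ hs) => i.
set f1 := frac_part _; set f2 := frac_part _.
have /andP[a1 a2] := frac_part_itv (gam * (tnth s.1.1 i).2); rewrite -/f1 in a1 a2.
have /andP[a3 a4] := frac_part_itv (gam * (tnth s.1.2 i).2); rewrite -/f2 in a3 a4.
set W := _ + f1 + f2.
have /andP[w1 w2] := floor_itv W; rewrite intrD in w2.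
have WE : W = y i + gam * ((tnth s.1.1 i).1 - (tnth s.1.1 i).2 - m1) +
    gam * ((tnth s.1.2 i).1 - (tnth s.1.2 i).2 - m2) + gam * (tnth s.2 i - m3) + f1 + f2.
  by rewrite /W /residual_noise /y; ring.
rewrite -/(y i); move: WE w1 w2; set Z := _ + gam * (tnth s.2 i - m3) => -> w1 w2.
by rewrite ler_norml; apply/andP; split; lra.
Qed.


(** A real mass function on a finite set, independent of the codebooks: averaging over codebooks
    becomes an exchange of finite sums. *)
Definition eff_noise_prob (h : V * V) (tau : V) : R := fine (P3 (eff_noise h.1 h.2 @^-1` [set tau])).

Lemma measurable_eff_noise_preimage h1 h2 (S : set V) : measurable (eff_noise h1 h2 @^-1` S).
Proof. exact: (measurable_fibres_preimage _ (measurable_fibres_eff_noise _ _ _ _ _ _ _ _)). Qed.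

Lemma eff_noise_probE h tau : P3 (eff_noise h.1 h.2 @^-1` [set tau]) = (eff_noise_prob h tau)%:E.
Proof. by rewrite /eff_noise_prob fineK// fin_num_measure//; exact: measurable_eff_noise_preimage. Qed.

Lemma eff_noise_prob_ge0 h tau : 0 <= eff_noise_prob h tau.
Proof. by rewrite -lee_fin -eff_noise_probE. Qed.

Lemma sum_eff_noise_prob h : \sum_tau eff_noise_prob h tau = 1.
Proof.
apply: EFin_inj; rewrite -sumEFin.
have := @integral_fibres _ _ R _ P3 (eff_noise h.1 h.2) (fun=> 1) (measurable_fibres_eff_noise _ _ _ _ _ _ _ _) (fun=> ler01).
rewrite integral_prob_cst => ->; apply: eq_bigr => tau _.
by rewrite mul1e; apply/esym; exact: eff_noise_probE.
Qed.

Variable v : books.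

Definition bad_event w (h : V * V) : set S3 :=
  eff_noise h.1 h.2 @^-1` [set tau | ~~ grid_ball t2 tau || collides v w tau].

(** If a residue is uncovered the right side is at least 1. Otherwise the noise leaves its ball with
    probability at most [eps], and the collisions are summed over the values of the noise. *)
Lemma bad_event_le w h : (P3 (bad_event w h) <= ((uncovered h.1)%:R + (uncovered h.2)%:R + eps
  + \sum_tau eff_noise_prob h tau * (collides v w tau)%:R)%:E)%E.
Proof.
have S0 : 0 <= \sum_tau eff_noise_prob h tau * (collides v w tau)%:R.
  by apply: sumr_ge0 => tau _; rewrite mulr_ge0// eff_noise_prob_ge0.
have P1 : (P3 (bad_event w h) <= 1)%E by apply: probability_le1; exact: measurable_eff_noise_preimage.
have [u1|c1] := boolP (uncovered h.1).
  by apply: (le_trans P1); rewrite lee_fin -!addrA lerDl !addr_ge0.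
have [u2|c2] := boolP (uncovered h.2).
  by apply: (le_trans P1); rewrite lee_fin add0r -!addrA lerDl !addr_ge0.
rewrite !add0r EFinD.
pose F tau := if collides v w tau then eff_noise h.1 h.2 @^-1` [set tau] else set0.
have mF tau : measurable (F tau) by rewrite /F; case: ifP => // _; exact: measurable_eff_noise_preimage.
pose C := eff_noise h.1 h.2 @^-1` [set tau | collides v w tau].
have mC : measurable C by exact: measurable_eff_noise_preimage.
have PC : (P3 C <= (\sum_tau eff_noise_prob h tau * (collides v w tau)%:R)%:E)%E.
  apply: (le_trans (measure_finite_cover P3 mC mF _)).
    by move=> s Cs; exists (eff_noise h.1 h.2 s); rewrite /F ifT.
  rewrite -sumEFin; apply: lee_sum => tau _; rewrite /F; case: ifP => _.
    by rewrite mulr1 le_eqVlt; apply/orP; left; apply/eqP; exact: eff_noise_probE.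
  by rewrite measure0 mulr0.
apply: le_trans (leeD (eff_noise_outside_le c1 c2) PC).
have mB := measurable_eff_noise_preimage h.1 h.2 [set tau | ~~ grid_ball t2 tau].
apply: le_trans (measureU2 _ mB mC); apply: le_measure; rewrite ?inE//.
- exact: measurable_eff_noise_preimage.
- exact: measurableU.
- by move=> s /orP[]; [left|right].
Qed.

Lemma card_rV_neq0 : (#|{: V}|%:R : R) != 0.
Proof. by rewrite pnatr_eq0 -lt0n; apply/card_gt0P; exists 0. Qed.

Lemma sum_pair_avg (f : V -> R) :
  \sum_(h : V * V) f h.1 * (#|{: V}|%:R^-1 * #|{: V}|%:R^-1) = (\sum_h f h) / #|{: V}|%:R.
Proof.
rewrite -(pair_bigA _ (fun a b => f a * (#|{: V}|%:R^-1 * #|{: V}|%:R^-1))) /=.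
rewrite mulr_suml; apply: eq_bigr => a _.
by rewrite sumr_const -[LHS]mulr_natr -!mulrA mulVf ?mulr1 ?card_rV_neq0.
Qed.

Lemma sum_pair_avg2 (f : V -> R) :
  \sum_(h : V * V) f h.2 * (#|{: V}|%:R^-1 * #|{: V}|%:R^-1) = (\sum_h f h) / #|{: V}|%:R.
Proof.
rewrite -sum_pair_avg -(pair_bigA _ (fun a b => f b * (#|{: V}|%:R^-1 * #|{: V}|%:R^-1))).
rewrite -(pair_bigA _ (fun a b => f a * (#|{: V}|%:R^-1 * #|{: V}|%:R^-1))) /=.
exact: exchange_big.
Qed.

Definition uncovered_frac : R := #|[pred h | uncovered h]|%:R / #|{: V}|%:R.

Definition collision_prob w : R := \sum_(h : V * V)
  (\sum_tau eff_noise_prob h tau * (collides v w tau)%:R) * (#|{: V}|%:R^-1 * #|{: V}|%:R^-1).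

(** The event is split according to the pair of residues, uniform and independent of the side
    information. Each user contributes one [uncovered_frac]. *)
Lemma decoding_error_le w :
  (outcome_law N Q1 Q2 [set o : outcome (cd v) | decoded w o <> w] <=
    (2 * uncovered_frac + eps + collision_prob w)%:E)%E.
Proof.
pose q : R := #|{: V}|%:R^-1 * #|{: V}|%:R^-1.
have q0 : 0 <= q by rewrite mulr_ge0.
have mbad h : measurable (bad_event w h) by exact: measurable_eff_noise_preimage.
pose F (h : V * V) : set (outcome (cd v)) := [set o | [/\ bad_event w h o.1.1,
   residue1 w.1 o = h.1 & residue2 w.2 o = h.2]].
apply: (@le_trans _ _ (\sum_h outcome_law N Q1 Q2 (F h))%E).
  apply: (@measure_finite_cover _ _ _ _ _ F).
  - exact: measurable_decoded_neq.
  - by move=> h; exact: (law_residues N Q1 Q2 G b2 t2 gam be1 be2 mu w0 v w.1 w.2 h.1 h.2 (mbad h)).1.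
  - move=> o /= dw; exists (residue1 w.1 o, residue2 w.2 o); split=> //=.
    rewrite /bad_event /=; apply: contra_notT dw; rewrite negb_or negbK => /andP[zb nc].
    exact: (@lattice_dec_correct R n p k M1 M2 G b2 t2 gam be1 be2 mu w0 v w
      (residue1 w.1 o) (residue2 w.2 o) o.1.1 o.1.2 o.2 erefl erefl zb nc).
apply: (@le_trans _ _ (\sum_(h : V * V) (((uncovered h.1)%:R + (uncovered h.2)%:R + eps
  + \sum_tau eff_noise_prob h tau * (collides v w tau)%:R) * q)%:E)%E).
  apply: lee_sum => h _; rewrite (law_residues N Q1 Q2 G b2 t2 gam be1 be2 mu w0 v w.1 w.2 h.1 h.2 (mbad h)).2 [leRHS]EFinM.
  by rewrite lee_wpmul2r ?lee_fin// bad_event_le.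
rewrite sumEFin lee_fin; under eq_bigr do rewrite !mulrDl.
rewrite !big_split /= /q (sum_pair_avg (fun h => (uncovered h)%:R)).
rewrite (sum_pair_avg2 (fun h => (uncovered h)%:R)) (sum_pair_avg (fun=> eps)).
have Nc : \sum_h (uncovered h)%:R = #|[pred h | uncovered h]|%:R :> R.
  by rewrite -sum_nat_pred natr_sum.
rewrite sumr_const -/(collision_prob w) lerD2r /uncovered_frac Nc -[eps *+ _]mulr_natr mulfK ?card_rV_neq0//.
lra.
Qed.

Lemma error_prob_le : (error_prob N Q1 Q2 (cd v) <=
  (2 * uncovered_frac + eps + (M1 * M2)%:R^-1 * \sum_w collision_prob w)%:E)%E.
Proof.
have M0 : ((M1 * M2)%:R : R) != 0.
  by rewrite pnatr_eq0 -lt0n muln_gt0; case: w0 => -[a ha] [b hb]; rewrite (leq_ltn_trans _ ha) ?(leq_ltn_trans _ hb).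
rewrite /error_prob.
apply: (@le_trans _ _ ((M1 * M2)%:R^-1%:E * \sum_(w : 'I_M1 * 'I_M2) (2 * uncovered_frac + eps + collision_prob w)%:E)%E).
  by rewrite lee_pmul2l ?lte_fin ?invr_gt0 ?lt0r ?M0 ?ler0n//; apply: lee_sum => w _; exact: decoding_error_le.
rewrite sumEFin -EFinM lee_fin big_split /= mulrDr lerD2r sumr_const card_prod !card_ord.
by rewrite -[X in _ * X]mulr_natl mulrA mulVf// mul1r.
Qed.
End error_bound.

(** * Averaging over codebooks *)

Section random_books.
Context {R : realType}.
Variables (N : R) (Q1 Q2 : probability (R * R)%type R).
Variables (n p k M1 M2 : nat).
Notation V := 'rV['F_p]_n.
Notation books := ({ffun 'I_M1 -> V} * {ffun 'I_M2 -> V})%type.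
Variables (G : 'M['F_p]_(k, n)) (b2 t2 gam be1 be2 m1 m2 m3 : R).
Variable w0 : 'I_M1 * 'I_M2.
Notation K := #|{: 'rV['F_p]_k}|.
Notation T := #|[pred g : V | grid_ball t2 g]|.

(** A union bound over the competing message pairs and the lattice points; each term is
    [card_collision] for a translate of the ball, which has [T] points as well. *)
Lemma card_collides (w : 'I_M1 * 'I_M2) (tau : V) :
  (#|[pred v : books | collides G t2 v w tau]| * #|{: V}| <=
   #|{: books}| * (M1 * M2 * K * T))%N.
Proof.
pose S u : pred V := [pred x | grid_ball t2 (x + tau - u *m G)].
have cS u : #|S u| = T.
  rewrite -[RHS]sum_nat_pred (reindex_inj (addIr (tau - u *m G))) sum_nat_pred.
  by apply: eq_card => x; rewrite !inE /= addrA.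
apply: (@leq_trans (\sum_(w' : 'I_M1 * 'I_M2) \sum_(u : 'rV['F_p]_k) #|{: books}| * T)%N); last first.
  rewrite !sum_nat_const (card_prod (ordinal M1)) !card_ord leq_eqVlt.
  by apply/orP; left; apply/eqP; ring.
rewrite -sum_nat_pred big_distrl /=.
apply: (@leq_trans (\sum_(v : books) (\sum_(w' | w' != w) \sum_u (S u (codesum v w - codesum v w')%R)) * #|{: V}|)%N).
  apply: leq_sum => v _; rewrite leq_mul2r; apply/orP; right.
  case: (boolP (collides _ _ _ _ _)) => // /existsP[w' /andP[w'w /existsP[u Su]]].
  by rewrite (bigD1 w')//= (bigD1 u)//= /S /= Su.
have e (v : books) : ((\sum_(w' | w' != w) \sum_u (S u (codesum v w - codesum v w')%R)) * #|{: V}| =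
    \sum_(w' | w' != w) \sum_u (S u (codesum v w - codesum v w')%R) * #|{: V}|)%N.
  by rewrite big_distrl; apply: eq_bigr => w' _; rewrite big_distrl.
rewrite (eq_bigr _ (fun v _ => e v)).
rewrite exchange_big /= [leqLHS]big_mkcond; apply: leq_sum => w' _; case: ifP => // w'w.
rewrite exchange_big; apply: leq_sum => u _.
by rewrite -big_distrl /= sum_nat_pred card_collision// cS.
Qed.

Notation cp v w := (@collision_prob R N Q1 Q2 n p k M1 M2 G b2 t2 gam be1 be2 m1 m2 m3 v w).

(** The noise law does not involve the codebooks, so the collision bound survives averaging over
    noise and residues; some codebook pair is no worse than the mean. *)
Lemma exists_books : exists v : books,
  (M1 * M2)%:R^-1 * \sum_w cp v w <= (M1 * M2 * K * T)%:R / #|{: V}|%:R.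
Proof.
set kap := _ / _.
have V0 : 0 < #|{: V}|%:R :> R by rewrite ltr0n; apply/card_gt0P; exists 0.
have hv w tau : \sum_(v : books) (collides G t2 v w tau)%:R <= #|{: books}|%:R * kap.
  rewrite -natr_sum sum_nat_pred /kap mulrA ler_pdivlMr// -!natrM ler_nat.
  exact: card_collides.
have M0 : 0 < (M1 * M2)%:R :> R.
  by rewrite ltr0n muln_gt0; case: w0 => -[a ha] [b hb]; rewrite (leq_ltn_trans _ ha) ?(leq_ltn_trans _ hb).
pose q : R := #|{: V}|%:R^-1 * #|{: V}|%:R^-1.
have q0 : 0 <= q by rewrite mulr_ge0// invr_ge0 ltW.
have hw w : \sum_(v : books) cp v w <= #|{: books}|%:R * kap.
  rewrite /collision_prob exchange_big /=.
  under eq_bigr do rewrite -mulr_suml exchange_big /=.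
  apply: (@le_trans _ _ (\sum_(h : V * V) (#|{: books}|%:R * kap) * q)).
    apply: ler_sum => h _; rewrite ler_wpM2r//.
    rewrite -[leRHS]mul1r -[X in _ <= X * _](sum_eff_noise_prob N Q1 Q2 G b2 gam be1 be2 m1 m2 m3 h).
    rewrite mulr_suml.
    apply: ler_sum => tau _; rewrite -mulr_sumr ler_wpM2l//.
    exact: eff_noise_prob_ge0.
  rewrite /q; have -> := @sum_pair_avg R n p (fun=> #|{: books}|%:R * kap).
  by rewrite sumr_const -[(_ * kap) *+ _]mulr_natr mulfK// gt_eqF.
have tot : \sum_(v : books) ((M1 * M2)%:R^-1 * \sum_w cp v w) <= #|{: books}|%:R * kap.
  rewrite -mulr_sumr exchange_big /= ler_pdivrMl//.
  apply: (@le_trans _ _ (\sum_(w : 'I_M1 * 'I_M2) #|{: books}|%:R * kap)).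
    by apply: ler_sum => w _; exact: hw.
  by rewrite sumr_const (card_prod (ordinal M1)) !card_ord [leRHS]mulr_natl.
apply/existsP; apply: contraT; rewrite negb_exists => /forallP nv.
have b0 : (0 < #|{: books}|)%N by apply/card_gt0P; exists ([ffun=> 0], [ffun=> 0]).
have : #|{: books}|%:R * kap < \sum_(v : books) ((M1 * M2)%:R^-1 * \sum_w cp v w).
  rewrite mulr_natl -sumr_const; apply: ltr_sum; last first.
    by move=> v _; rewrite ltNge.
  by apply/hasP; exists ([ffun=> 0], [ffun=> 0]); rewrite ?mem_index_enum.
by rewrite ltNge tot.
Qed.

End random_books.

(** * Transmitted power *)

Section power.
Context {R : realType}.
Variables (N : R) (Q1 Q2 : probability (R * R)%type R).
Variables (n p k M1 M2 : nat).
Notation V := 'rV['F_p]_n.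
Notation books := ({ffun 'I_M1 -> V} * {ffun 'I_M2 -> V})%type.
Variables (G : 'M['F_p]_(k, n)) (b2 t2 gam be1 be2 mu : R).
Variable w0 : 'I_M1 * 'I_M2.
Variable v : books.
Hypothesis pp : prime p.
Hypothesis n0 : (0 < n)%N.
Hypothesis b20 : 0 <= b2.
Notation cd := (lattice_code G b2 t2 gam be1 be2 mu w0).
Notation law := (outcome_law N Q1 Q2 (c := cd v)).
Notation U := (uncovered_frac G b2).

Definition rep_energy (be : R) (h : V) : R := sqnorm (scaled_rep G b2 be h).

Lemma rep_energy_ge0 be h : 0 <= rep_energy be h.
Proof. by rewrite /rep_energy /sqnorm sumr_ge0// => i _; rewrite sqr_ge0. Qed.

(** An uncovered residue is sent as it stands and may cost [p ^+ 2] per symbol, since [p] bounds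
    every lift. Uncovered residues must therefore be rarer than [p ^- 2]. *)
Lemma rep_energy_avg be :
  (\sum_h rep_energy be h) / #|{: V}|%:R <= n%:R * (be ^+ 2 * (b2 + U * p%:R ^+ 2)).
Proof.
have V0 : 0 < #|{: V}|%:R :> R by rewrite ltr0n; apply/card_gt0P; exists 0.
have hE h : rep_energy be h = be ^+ 2 * \sum_i lift_coord (coset_rep G b2 h) i ^+ 2.
  rewrite /rep_energy /sqnorm mulr_sumr; apply: eq_bigr => i _.
  by rewrite tnth_mktuple exprMn.
have hle h : rep_energy be h <= be ^+ 2 * (n%:R * b2 + (uncovered G b2 h)%:R * (n%:R * p%:R ^+ 2)).
  rewrite hE ler_wpM2l ?sqr_ge0//; have [_|/coset_rep_ball] := boolP (uncovered G b2 h); last first.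
    by rewrite mul0r addr0.
  move=> *; rewrite mul1r; apply: (@le_trans _ _ (n%:R * p%:R ^+ 2)); last first.
    by rewrite lerDr mulr_ge0.
  rewrite mulr_natl -[n in leRHS](card_ord n) -sumr_const; apply: ler_sum => i _.
  have := centered_lift_bound pp (coset_rep G b2 h 0 i); rewrite /lift_coord; move: (centered_lift _) => c hc.
  have : c ^+ 2 <= p%:Z ^+ 2 by nia.
  by rewrite -(ler_int R) !rmorphXn.
rewrite ler_pdivrMr//; apply: (le_trans (ler_sum _ (fun h _ => hle h))).
rewrite -mulr_sumr big_split /= sumr_const -mulr_suml.
have Nc : \sum_h (uncovered G b2 h)%:R = U * #|{: V}|%:R :> R.
  by rewrite -natr_sum sum_nat_pred /uncovered_frac divfK// gt_eqF.
by rewrite Nc -mulr_natr; lra.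
Qed.

Lemma sum_inv_card : \sum_(h : V) ((#|{: V}|%:R^-1 * #|{: V}|%:R^-1)%:E : \bar R) = (#|{: V}|%:R^-1)%:E.
Proof.
have V0 : #|{: V}|%:R != 0 :> R by rewrite pnatr_eq0 -lt0n; apply/card_gt0P; exists 0.
by rewrite sumEFin sumr_const -[(_ * _) *+ _]mulr_natr -mulrA mulVf ?mulr1.
Qed.

Lemma residue1_fibres w : measurable_fibres (@residue1 R n p k M1 M2 G b2 t2 gam be1 be2 mu w0 v w).
Proof.
move=> h.
rewrite (_ : _ @^-1` _ = \bigcup_(h2 in [set: V]) [set o | [/\ setT o.1.1,
   residue1 w o = h & residue2 w0.2 o = h2]]).
  apply: fin_bigcup_measurable; first exact: finite_finset.
  by move=> h2 _; exact: (law_residues N Q1 Q2 _ _ _ _ _ _ _ _ _ w w0.2 h h2 measurableT).1.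
by apply/seteqP; split => o /=; [move=> <-; exists (residue2 w0.2 o)|case=> h2 _ []].
Qed.

(** The residue of the other user, for the auxiliary message [w0.2], is summed out of the joint
    law. *)
Lemma residue1_law w h : (law [set o | residue1 w o = h] <= (#|{: V}|%:R^-1)%:E)%E.
Proof.
rewrite -sum_inv_card.
apply: (@le_trans _ _ (\sum_(h2 : V) law [set o | [/\ setT o.1.1, residue1 w o = h & residue2 w0.2 o = h2]])%E).
  apply: (@measure_finite_cover _ _ _ _ _ (fun h2 : V => [set o : outcome (cd v) | [/\ setT o.1.1, residue1 w o = h & residue2 w0.2 o = h2]])).
  - exact: residue1_fibres.
  - by move=> h2; exact: (law_residues N Q1 Q2 _ _ _ _ _ _ _ _ _ w w0.2 h h2 measurableT).1.
  - by move=> o /= oh; exists (residue2 w0.2 o).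
apply: lee_sum => h2 _.
rewrite (law_residues N Q1 Q2 _ _ _ _ _ _ _ _ _ w w0.2 h h2 measurableT).2.
by rewrite probability_setT mul1e.
Qed.

Lemma residue2_fibres w : measurable_fibres (@residue2 R n p k M1 M2 G b2 t2 gam be1 be2 mu w0 v w).
Proof.
move=> h.
rewrite (_ : _ @^-1` _ = \bigcup_(h2 in [set: V]) [set o | [/\ setT o.1.1,
   residue1 w0.1 o = h2 & residue2 w o = h]]).
  apply: fin_bigcup_measurable; first exact: finite_finset.
  by move=> h2 _; exact: (law_residues N Q1 Q2 _ _ _ _ _ _ _ _ _ w0.1 w h2 h measurableT).1.
by apply/seteqP; split => o /=; [move=> <-; exists (residue1 w0.1 o)|case=> h2 _ []].
Qed.

Lemma residue2_law w h : (law [set o | residue2 w o = h] <= (#|{: V}|%:R^-1)%:E)%E.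
Proof.
rewrite -sum_inv_card.
apply: (@le_trans _ _ (\sum_(h2 : V) law [set o | [/\ setT o.1.1, residue1 w0.1 o = h2 & residue2 w o = h]])%E).
  apply: (@measure_finite_cover _ _ _ _ _ (fun h2 : V => [set o : outcome (cd v) | [/\ setT o.1.1, residue1 w0.1 o = h2 & residue2 w o = h]])).
  - exact: residue2_fibres.
  - by move=> h2; exact: (law_residues N Q1 Q2 _ _ _ _ _ _ _ _ _ w0.1 w h2 h measurableT).1.
  - by move=> o /= oh; exists (residue1 w0.1 o).
apply: lee_sum => h2 _.
rewrite (law_residues N Q1 Q2 _ _ _ _ _ _ _ _ _ w0.1 w h2 h measurableT).2.
by rewrite probability_setT mul1e.
Qed.

Lemma power1_le : (power1 N Q1 Q2 (cd v) <= (be1 ^+ 2 * (b2 + U * p%:R ^+ 2))%:E)%E.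
Proof.
set X := be1 ^+ 2 * _.
have I w : (\int[law]_o (sqnorm (input1 w o))%:E <= (n%:R * X)%:E)%E.
  have L : (\int[law]_o (sqnorm (input1 w o))%:E =
      \sum_h (rep_energy be1 h)%:E * law [set o | residue1 w o = h])%E.
    exact: (@integral_fibres _ _ R _ law (@residue1 R n p k M1 M2 G b2 t2 gam be1 be2 mu w0 v w)
      (rep_energy be1) (residue1_fibres w) (rep_energy_ge0 be1)).
  rewrite L; apply: (@le_trans _ _ (\sum_h (rep_energy be1 h / #|{: V}|%:R)%:E)%E).
    apply: lee_sum => h _; rewrite EFinM lee_wpmul2l ?lee_fin ?rep_energy_ge0//.
    exact: residue1_law.
  by rewrite sumEFin lee_fin -mulr_suml rep_energy_avg.
have M0 : 0 < M1%:R :> R by rewrite ltr0n (leq_ltn_trans _ (ltn_ord w0.1)).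
have nR : 0 < n%:R :> R by rewrite ltr0n.
rewrite /power1; apply: (@le_trans _ _ ((n%:R^-1)%:E * ((M1%:R^-1)%:E * \sum_(w : 'I_M1) (n%:R * X)%:E))%E).
  rewrite lee_pmul2l ?lte_fin ?invr_gt0// lee_pmul2l ?lte_fin ?invr_gt0//.
  by apply: lee_sum => w _; exact: I.
rewrite sumEFin -!EFinM lee_fin sumr_const card_ord -[(_ * X) *+ _]mulr_natl.
by rewrite mulKf ?gt_eqF// mulKf ?gt_eqF.
Qed.

Lemma power2_le : (power2 N Q1 Q2 (cd v) <= (be2 ^+ 2 * (b2 + U * p%:R ^+ 2))%:E)%E.
Proof.
set X := be2 ^+ 2 * _.
have I w : (\int[law]_o (sqnorm (input2 w o))%:E <= (n%:R * X)%:E)%E.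
  have L : (\int[law]_o (sqnorm (input2 w o))%:E =
      \sum_h (rep_energy be2 h)%:E * law [set o | residue2 w o = h])%E.
    exact: (@integral_fibres _ _ R _ law (@residue2 R n p k M1 M2 G b2 t2 gam be1 be2 mu w0 v w)
      (rep_energy be2) (residue2_fibres w) (rep_energy_ge0 be2)).
  rewrite L; apply: (@le_trans _ _ (\sum_h (rep_energy be2 h / #|{: V}|%:R)%:E)%E).
    apply: lee_sum => h _; rewrite EFinM lee_wpmul2l ?lee_fin ?rep_energy_ge0//.
    exact: residue2_law.
  by rewrite sumEFin lee_fin -mulr_suml rep_energy_avg.
have M0 : 0 < M2%:R :> R by rewrite ltr0n (leq_ltn_trans _ (ltn_ord w0.2)).
have nR : 0 < n%:R :> R by rewrite ltr0n.
rewrite /power2; apply: (@le_trans _ _ ((n%:R^-1)%:E * ((M2%:R^-1)%:E * \sum_(w : 'I_M2) (n%:R * X)%:E))%E).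
  rewrite lee_pmul2l ?lte_fin ?invr_gt0// lee_pmul2l ?lte_fin ?invr_gt0//.
  by apply: lee_sum => w _; exact: I.
rewrite sumEFin -!EFinM lee_fin sumr_const card_ord -[(_ * X) *+ _]mulr_natl.
by rewrite mulKf ?gt_eqF// mulKf ?gt_eqF.
Qed.

End power.

Lemma exists_code (R : realType) (N : R) (Q1 Q2 : probability (R * R)%type R)
    (n p k M1 M2 : nat) (G : 'M['F_p]_(k, n)) (b2 t2 gam be1 be2 m1 m2 m3 om2 eps eta : R) :
  prime p -> (0 < n)%N -> (0 < M1)%N -> (0 < M2)%N -> 0 <= b2 -> 0 <= eps -> 0 < eta ->
  (1 + eta) * om2 + (1 + eta^-1) * 2 ^+ 2 <= t2 ->
  (gam * be1 - 1) * (gam * be2 - 1) = 0 ->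
  (forall y : 'I_n -> R,
    \sum_i y i ^+ 2 <= n%:R * (((gam * be1 - 1) ^+ 2 + (gam * be2 - 1) ^+ 2) * b2) ->
    (side_law N Q1 Q2 [set s | (n%:R * om2 <
      \sum_i (y i + gam * ((tnth s.1.1 i).1 - (tnth s.1.1 i).2 - m1)
      + gam * ((tnth s.1.2 i).1 - (tnth s.1.2 i).2 - m2) + gam * (tnth s.2 i - m3)) ^+ 2)%R]
     <= eps%:E)%E) ->
  exists c : Defs.code R n M1 M2,
    [/\ (error_prob N Q1 Q2 c <= (2 * uncovered_frac G b2 + eps +
           (M1 * M2 * #|{: 'rV['F_p]_k}| * #|[pred g : 'rV['F_p]_n | grid_ball t2 g]|)%:R
             / #|{: 'rV['F_p]_n}|%:R)%:E)%E,
        (power1 N Q1 Q2 c <= (be1 ^+ 2 * (b2 + uncovered_frac G b2 * p%:R ^+ 2))%:E)%E &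
        (power2 N Q1 Q2 c <= (be2 ^+ 2 * (b2 + uncovered_frac G b2 * p%:R ^+ 2))%:E)%E].
Proof.
move=> pp n0 M10 M20 b20 eps0 eta0 hom hc hnoise.
pose w0 : 'I_M1 * 'I_M2 := (Ordinal M10, Ordinal M20).
have [v hv] := exists_books N Q1 Q2 G b2 t2 gam be1 be2 m1 m2 m3 w0.
exists (lattice_code G b2 t2 gam be1 be2 (m1 + m2 + m3) w0 v); split.
- apply: (le_trans (@error_prob_le R N Q1 Q2 n p k M1 M2 G b2 t2 gam be1 be2 m1 m2 m3 w0 pp
    om2 eps eta eps0 eta0 hom hc hnoise v)).
  by rewrite lee_fin lerD2l.
- exact: power1_le.
- exact: power2_le.
Qed.

(** * Asymptotics *)

(** The least [k] reaching [W] overshoots by a factor of at most [p]; for [k = 0] the upper bound is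
    the hypothesis on [b]. It yields the dimension of the lattice code. *)
Lemma exists_exponent (p b W : nat) : (1 < p)%N -> (0 < b)%N -> (b <= p * W)%N ->
  exists k, (W <= p ^ k * b)%N /\ (p ^ k * b <= p * W)%N.
Proof.
move=> p1 b0 bW.
have ex : exists k, (W <= p ^ k * b)%N.
  exists W; apply: leq_trans (leq_pmulr _ b0); exact: ltnW (ltn_expl _ p1).
case: (ex_minnP ex) => -[|k] hk kmin; first by exists 0%N; rewrite expn0 mul1n in hk *.
exists k.+1; split=> //; rewrite expnS -mulnA leq_mul2l; apply/orP; right.
by rewrite ltnW// ltnNge; apply/negP => /kmin; rewrite ltnn.
Qed.

Section asymptotics.
Context {R : realType}.

Lemma num_messages_gt0 n (r : R) : (0 < num_messages n r)%N.
Proof. by rewrite /num_messages absz_gt0 gt_eqF// ceil_gt0 powR_gt0. Qed.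

Lemma num_messages_le n (r : R) : 0 <= r ->
  (num_messages n r)%:R <= 2 * expR (n%:R * (r * ln 2)) :> R.
Proof.
move=> r0; pose x : R := 2 `^ (n%:R * r).
have xE : x = expR (n%:R * (r * ln 2)) by rewrite /x /powR pnatr_eq0 /= mulrA.
have ln2 : 0 <= ln (2 : R) by rewrite ln_ge0// ler1n.
have x1 : 1 <= x by rewrite xE -[leLHS]expR0 ler_expR !mulr_ge0.
rewrite -xE /num_messages -/x natr_absz ger0_norm; last first.
  by rewrite ltW// ceil_gt0 (lt_le_trans ltr01).
have := ceilB1_lt x; rewrite intrB rmorph1; lra.
Qed.

Lemma codes_exist_eventually (P1 P2 N : R) (Q1 Q2 : probability (R * R)%type R)
    (gam be1 be2 b2 t2 eta dl m1 m2 m3 K1 K2 K3 : R) (m k0 : nat) (r1 r2 : R) :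
  centered Q1 (fun t => gam * (t.1 - t.2 - m1)) K1 ->
  centered Q2 (fun t => gam * (t.1 - t.2 - m2)) K2 ->
  centered (noise_law N) (fun z => gam * (z - m3)) K3 ->
  0 < b2 -> 0 < eta -> 0 < dl ->
  (gam * be1 - 1) * (gam * be2 - 1) = 0 ->
  (1 + eta) * (((gam * be1 - 1) ^+ 2 + (gam * be2 - 1) ^+ 2) * b2 + K1 + K2 + K3 + dl)
    + (1 + eta^-1) * 2 ^+ 2 <= t2 ->
  (0 < m)%N -> (0 < k0)%N ->
  (1 + eta) * ((m%:R / k0%:R) ^+ 2 * t2) + (1 + eta^-1) * (m%:R / k0%:R + 1) ^+ 2 <= b2 ->
  be1 ^+ 2 * b2 < P1 -> be2 ^+ 2 * b2 < P2 -> 0 <= r1 -> 0 <= r2 ->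
  (r1 + r2) * ln 2 < ln (m%:R / k0%:R) ->
  forall e : R, 0 < e -> exists n0, forall n, (n0 <= n)%N ->
  exists c : Defs.code R n (num_messages n r1) (num_messages n r2),
    [/\ (error_prob N Q1 Q2 c <= e%:E)%E, (power1 N Q1 Q2 c <= P1%:E)%E &
        (power2 N Q1 Q2 c <= P2%:E)%E].
Proof.
move=> C1 C2 C3 b20 eta0 dl0 hc ht m0 k00 hb hP1 hP2 r10 r20 hr e e0.
set A := _ * b2 in ht.
have A0 : 0 <= A by rewrite mulr_ge0 ?addr_ge0 ?sqr_ge0// ltW.
have e3 : 0 < e / 3 by rewrite divr_gt0.
have [na hna] := noise_norm C1 C2 C3 A0 dl0 e3.
(* The rate gap in nats: half of it pays for the factor [n * p ^+ 3], the other half drives the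
   collision probability to 0. *)
pose L := ln (m%:R / k0%:R : R) - (r1 + r2) * ln 2.
have L0 : 0 < L by rewrite subr_gt0.
have [nb hnb] := exists_prime_subexp b20 L0.
(* The summands serve, in order, the uncovered residues, the power slack of each user, and the
   collision bound [32 * expR (- (n * L / 2)) <= e / 3], via [1 + x <= expR x]. *)
pose y := 6 / e + be1 ^+ 2 / (P1 - be1 ^+ 2 * b2) + be2 ^+ 2 / (P2 - be2 ^+ 2 * b2) + 192 / (e * L).
have d1 : 0 < P1 - be1 ^+ 2 * b2 by rewrite subr_gt0.
have d2 : 0 < P2 - be2 ^+ 2 * b2 by rewrite subr_gt0.
exists (maxn (maxn na nb) (Num.truncn y).+1) => n; rewrite !geq_max -andbA => /and3P[/hna{}hna /hnb{}hnb hn].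
have n0 : (0 < n)%N by apply: leq_ltn_trans hn.
have nR : 0 < n%:R :> R by rewrite ltr0n.
have ny : y <= n%:R.
  by apply: ltW; apply: lt_le_trans (truncnS_gt _) _; rewrite ler_nat.
have y1 : 0 <= 6 / e by rewrite divr_ge0// ltW.
have y2 : 0 <= be1 ^+ 2 / (P1 - be1 ^+ 2 * b2) by rewrite divr_ge0 ?sqr_ge0// ltW.
have y3 : 0 <= be2 ^+ 2 / (P2 - be2 ^+ 2 * b2) by rewrite divr_ge0 ?sqr_ge0// ltW.
have y4 : 0 <= 192 / (e * L) by rewrite divr_ge0// mulr_ge0// ltW.
have n1 : 6 / e <= n%:R by move: ny; clear -y1 y2 y3 y4; rewrite /y; lra.
have n2 : be1 ^+ 2 / (P1 - be1 ^+ 2 * b2) <= n%:R by move: ny; clear -y1 y2 y3 y4; rewrite /y; lra.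
have n3 : be2 ^+ 2 / (P2 - be2 ^+ 2 * b2) <= n%:R by move: ny; clear -y1 y2 y3 y4; rewrite /y; lra.
have n4 : 192 / (e * L) <= n%:R by move: ny; clear -y1 y2 y3 y4; rewrite /y; lra.
have [p [pp hp1 hp2]] := hnb.
have p0 : 0 < p%:R :> R by rewrite ltr0n prime_gt0.
set T := #|[pred g : 'rV['F_p]_n | grid_ball t2 g]|.
set b := #|[pred g : 'rV['F_p]_n | grid_ball b2 g]|.
have cV : #|{: 'rV['F_p]_n}| = (p ^ n)%N by rewrite card_mx card_Fp// mul1n.
have ratio : (T * m ^ n <= b * k0 ^ n)%N := card_grid_ball_ratio pp m0 k00 eta0 hb hp1.
have bpos : (0 < b)%N.
  apply/card_gt0P; exists 0; rewrite inE /= /grid_ball big1; first by rewrite mulr_ge0// ltW.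
  move=> i _; rewrite /lift_coord mxE.
  by have := @centered_lift_small p pp 0; rewrite /= mulr0z => ->; rewrite ?expr0n ?mulr0z// prime_gt0.
have bV : (b <= p ^ n)%N by rewrite -cV; exact: max_card.
(* The surplus [n * p ^ 2] over [p ^ n] makes the uncovered fraction at most [(n * p ^ 2)^-1], so
   that its energy [p ^ 2] per symbol still vanishes as [n] grows. *)
pose W := (n * p ^ 2 * p ^ n)%N.
have bW : (b <= p * W)%N.
  by rewrite (leq_trans bV)// /W mulnA leq_pmull// !muln_gt0 n0 !prime_gt0//= expn_gt0 prime_gt0.
have [k [hk1 hk2]] := exists_exponent (prime_gt1 pp) bpos bW.
have cK : #|{: 'rV['F_p]_k}| = (p ^ k)%N by rewrite card_mx card_Fp// mul1n.
have [G hG] := @exists_good_lattice _ k n (@grid_ball p R n b2).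
have pn0 : (0 < p ^ n)%N by rewrite expn_gt0 prime_gt0.
have hU : uncovered_frac G b2 <= (n%:R * p%:R ^+ 2)^-1 :> R.
  have hG' : (#|[pred h | uncovered G b2 h]| * (p ^ k * b) <= p ^ n * p ^ n)%N.
    by rewrite -cV -cK; exact: hG.
  rewrite /uncovered_frac cV ler_pdivrMr ?ltr0n// ler_pdivlMl ?mulr_gt0 ?exprn_gt0//.
  rewrite -natrX -!natrM ler_nat -(leq_pmul2r pn0); apply: leq_trans hG'.
  by rewrite mulnAC mulnC leq_mul2l; apply/orP; right; exact: hk1.
have U0 : 0 <= uncovered_frac G b2 :> R by rewrite divr_ge0.
have Up : uncovered_frac G b2 * p%:R ^+ 2 <= n%:R^-1 :> R.
  by rewrite -ler_pdivlMr ?exprn_gt0// -invfM.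
have power_le (be P : R) : 0 < P - be ^+ 2 * b2 -> be ^+ 2 / (P - be ^+ 2 * b2) <= n%:R ->
    be ^+ 2 * (b2 + uncovered_frac G b2 * p%:R ^+ 2) <= P.
  move=> dP; rewrite ler_pdivrMr// => hPn.
  have := ler_wpM2l (sqr_ge0 be) Up; have : be ^+ 2 / n%:R <= P - be ^+ 2 * b2.
    by rewrite ler_pdivrMr// mulrC.
  by clear; rewrite mulrDr; lra.
have hnoise : forall y : 'I_n -> R, \sum_i y i ^+ 2 <= n%:R * A ->
    (side_law N Q1 Q2 [set s | (n%:R * (A + K1 + K2 + K3 + dl) <
      \sum_i (y i + gam * ((tnth s.1.1 i).1 - (tnth s.1.1 i).2 - m1)
      + gam * ((tnth s.1.2 i).1 - (tnth s.1.2 i).2 - m2) + gam * (tnth s.2 i - m3)) ^+ 2)%R]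
     <= (e / 3)%:E)%E.
  by move=> z hz; exact: hna.
have [c [ce cp1 cp2]] := exists_code G pp n0 (num_messages_gt0 n r1) (num_messages_gt0 n r2)
  (ltW b20) (ltW e3) eta0 ht hc hnoise.
exists c; split.
- apply: (le_trans ce); rewrite lee_fin cV cK -/T.
  have U3 : 2 * uncovered_frac G b2 <= e / 3.
    have p21 : 1 <= p%:R ^+ 2 :> R by rewrite exprn_ege1// ler1n prime_gt0.
    have := ler_wpM2l U0 p21; rewrite mulr1 => h.
    have ni : n%:R^-1 <= e / 6 by rewrite -[leRHS]invf_div lef_pV2 ?posrE// divr_gt0.
    by clear -h ni Up; lra.
  (* The ball comparison trades [T] for [b], and [p ^ k * b] exceeds [p ^ n] by at most [n * p ^ 3]:
     the surplus in [W] and the overshoot [p] of [exists_exponent]. *)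
  have cnt : (p ^ k * T * m ^ n <= n * p ^ 3 * p ^ n * k0 ^ n)%N.
    rewrite -mulnA (leq_trans (leq_mul (leqnn _) ratio))// mulnA leq_mul2r.
    apply/orP; right; apply: (leq_trans hk2); rewrite /W leq_eqVlt; apply/orP; left.
    by clear; apply/eqP; ring.
  set M12 := (num_messages n r1 * num_messages n r2)%N.
  have mk0 : 0 < m%:R / k0%:R :> R by rewrite divr_gt0 ?ltr0n.
  have lamE : (m%:R / k0%:R) ^+ n = expR (n%:R * ln (m%:R / k0%:R)) :> R.
    by rewrite expRM_natl lnK.
  have c1 : (p ^ k * T)%:R / (p ^ n)%:R <= n%:R * p%:R ^+ 3 * expR (- (n%:R * ln (m%:R / k0%:R))) :> R.
    rewrite expRN -lamE ler_pdivlMr ?exprn_gt0// expr_div_n mulf_div.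
    rewrite ler_pdivrMr ?mulr_gt0 ?exprn_gt0 ?ltr0n// -!natrX -!natrM ler_nat.
    by move: cnt; rewrite !mulnA.
  have c2 : M12%:R <= 4 * expR (n%:R * ((r1 + r2) * ln 2)) :> R.
    rewrite (_ : n%:R * ((r1 + r2) * ln 2) = n%:R * (r1 * ln 2) + n%:R * (r2 * ln 2)); last first.
      by clear; ring.
    rewrite /M12 natrM expRD.
    apply: (le_trans (ler_pM _ _ (num_messages_le n r10) (num_messages_le n r20))) => //.
    by rewrite le_eqVlt; apply/orP; left; apply/eqP; clear; ring.
  have c3 : (M12 * p ^ k * T)%:R / (p ^ n)%:R <= 32 * expR (- (n%:R * (L / 2))) :> R.
    rewrite -mulnA natrM -mulrA.
    apply: (@le_trans _ _ ((4 * expR (n%:R * ((r1 + r2) * ln 2))) *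
       (8 * expR (n%:R * (L / 2)) * expR (- (n%:R * ln (m%:R / k0%:R)))))).
      apply: ler_pM => //.
      by apply: (le_trans c1); rewrite ler_pM2r ?expR_gt0.
    have -> : - (n%:R * (L / 2)) = n%:R * ((r1 + r2) * ln 2) + (n%:R * (L / 2) + - (n%:R * ln (m%:R / k0%:R))).
      by rewrite /L; clear; field.
    by rewrite !expRD; clear; lra.
  have c4 : 32 * expR (- (n%:R * (L / 2))) <= e / 3.
    have nL : 0 < n%:R * (L / 2) by rewrite mulr_gt0// divr_gt0.
    rewrite expRN ler_pdivrMr ?expR_gt0//.
    have := expR_ge1Dx (n%:R * (L / 2)).
    move: n4; rewrite ler_pdivrMr ?mulr_gt0// => n4 h.
    have := ler_wpM2l (ltW e3) h; clear -n4 e3; lra.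
  by have c5 := le_trans c3 c4; clear -c5 U3; lra.
- by apply: (le_trans cp1); rewrite lee_fin; exact: power_le.
- by apply: (le_trans cp2); rewrite lee_fin; exact: power_le.
Qed.
End asymptotics.

(** * From codes at large block lengths to attained rates *)

Section attained.
Context {R : realType}.

(** Subtracting the mean only lowers the second moment, so biased estimates cause no loss; the
    decoder removes the means through [mu]. *)
Lemma centered_exists d (T : measurableType d) (Q : probability T R) (f : T -> R) (E gam : R) :
  measurable_fun setT f -> (\int[Q]_t (f t ^+ 2)%:E <= E%:E)%E ->
  exists m K, K <= gam ^+ 2 * E /\ centered Q (fun t => gam * (f t - m)) K.
Proof.
move=> mf hE.
have mf2 : measurable_fun setT (fun t => (f t ^+ 2)%R) by exact: measurable_funX.
have [S hS SE] : exists2 S, (\int[Q]_t (f t ^+ 2)%:E = S%:E)%E & S <= E.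
  move: hE; have : (0 <= \int[Q]_t (f t ^+ 2)%:E)%E by apply: integral_ge0 => t _; rewrite lee_fin sqr_ge0.
  by case: (integral _ _ _) => // a _; rewrite lee_fin; exists a.
have if2 : Q.-integrable setT (EFin \o (fun t => (f t ^+ 2)%R)).
  apply/integrableP; split; first exact/measurable_EFinP.
  rewrite (eq_integral (fun t => (f t ^+ 2)%:E)) ?hS ?ltry// => t _ /=.
  by rewrite ger0_norm ?sqr_ge0.
have intf : Q.-integrable setT (EFin \o f).
  apply: (@le_integrable _ _ _ Q _ measurableT _ (fun t => (1 + f t ^+ 2)%:E)).
  - exact/measurable_EFinP.
  - move=> t _ /=; rewrite lee_fin [leRHS]ger0_norm ?addr_ge0 ?sqr_ge0//.
    have := sqr_ge0 (`|f t| - 1); rewrite -[f t ^+ 2]real_normK ?num_real//; nra.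
  - apply: (eq_integrable measurableT (cst 1%:E \+ (EFin \o (fun t => (f t ^+ 2)%R)))%E) => //.
    by apply: integrableD => //; exact: finite_measure_integrable_cst.
have [m hm] : exists m, (\int[Q]_t (f t)%:E = m%:E)%E.
  by exists (fine (\int[Q]_t (f t)%:E)%E); rewrite fineK//; exact: integrable_fin_num.
have intg : Q.-integrable setT (EFin \o (fun t => (f t - m)%R)).
  apply: (eq_integrable measurableT ((EFin \o f) \- cst m%:E)%E) => //.
  by apply: integrableB => //; exact: finite_measure_integrable_cst.
have g1 : (\int[Q]_t (f t - m)%:E = 0)%E.
  rewrite (eq_integral (fun t => (EFin \o f) t - (cst m%:E) t)%E)//.
  rewrite integralB//; last exact: finite_measure_integrable_cst.
  by rewrite hm integral_prob_cst subee.
have g2 : (\int[Q]_t ((f t - m) ^+ 2)%:E = (S - m ^+ 2)%:E)%E.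
  rewrite (eq_integral (fun t => (EFin \o (fun t => (f t ^+ 2)%R)) t +
      ((- (2 * m))%:E * (EFin \o (fun t => (f t - m)%R)) t + (cst (- m ^+ 2)%:E) t))%E); last first.
    by move=> t _; rewrite /= -EFinM -!EFinD; congr EFin; ring.
  have i1 := integrableZl measurableT (- (2 * m)) intg.
  have i2 : Q.-integrable setT (cst (- m ^+ 2)%:E) by exact: finite_measure_integrable_cst.
  rewrite integralD//; last exact: (integrableD measurableT i1 i2).
  rewrite integralD// integralZl// hS g1 mule0 add0e integral_prob_cst.
  by rewrite -EFinD.
have intk : Q.-integrable setT (fun t => gam%:E * (EFin \o (fun t => (f t - m)%R)) t)%E.
  exact: integrableZl.
exists m, (gam ^+ 2 * (S - m ^+ 2)); split.
  by rewrite ler_wpM2l ?sqr_ge0// (le_trans _ SE)// gerBl sqr_ge0.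
split.
- by apply: measurable_funM => //; exact: measurable_funB.
- by apply: (eq_integrable measurableT (fun t => gam%:E * (EFin \o (fun t => (f t - m)%R)) t)%E).
- by rewrite (eq_integral (fun t => gam%:E * (EFin \o (fun t => (f t - m)%R)) t)%E)// integralZl// g1 mule0.
- rewrite (eq_integral (fun t => (gam ^+ 2)%:E * ((f t - m) ^+ 2)%:E)%E); last first.
    by move=> t _; rewrite exprMn EFinM.
  rewrite ge0_integralZl ?lee_fin ?sqr_ge0// ?g2 -?EFinM//.
    by apply/measurable_EFinP; apply: measurable_funX; exact: measurable_funB.
  by move=> t _; rewrite lee_fin sqr_ge0.
Qed.

(* Fills in the block lengths for which no good code is available yet. *)
Definition zero_code n M1 M2 (w0 : 'I_M1 * 'I_M2) : Defs.code R n M1 M2.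
Proof.
refine (@Defs.Code R n M1 M2 _ _ bool bool (dirac true) (dirac true)
  (fun _ _ => [tuple 0 | i < n]) (fun _ _ => [tuple 0 | i < n]) (fun=> w0) _ _ _).
- by move=> w; exact: measurable_cst.
- by move=> w; exact: measurable_cst.
- move=> m; have [->|/eqP wm] := eqVneq w0 m.
    by rewrite (_ : _ @^-1` _ = setT)//; apply/seteqP; split.
  by rewrite (_ : _ @^-1` _ = set0)//; apply/seteqP; split => // x /= /wm.
Defined.

(** Codes of different accuracies are merged into one sequence: at length [n] the code of accuracy
    [1 / (j + 1)] is used for the largest available [j <= n]. For each fixed [j] this accuracy is
    eventually reached. *)
Lemma attained_of_eventually (P1 P2 N : R) (Q1 Q2 : probability (R * R)%type R) (r1 r2 : R) :
  0 <= P1 -> 0 <= P2 -> 0 <= r1 -> 0 <= r2 ->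
  (forall e : R, 0 < e -> exists n0, forall n, (n0 <= n)%N ->
    exists c : Defs.code R n (num_messages n r1) (num_messages n r2),
    [/\ (error_prob N Q1 Q2 c <= e%:E)%E, (power1 N Q1 Q2 c <= P1%:E)%E &
        (power2 N Q1 Q2 c <= P2%:E)%E]) ->
  attained_rates P1 P2 N Q1 Q2 (r1, r2).
Proof.
move=> P10 P20 r10 r20 H; split => //=.
pose ok n j := exists c : Defs.code R n (num_messages n r1) (num_messages n r2),
    [/\ (error_prob N Q1 Q2 c <= (j.+1%:R^-1)%:E)%E, (power1 N Q1 Q2 c <= P1%:E)%E &
        (power2 N Q1 Q2 c <= P2%:E)%E].
have sel n : exists c : Defs.code R n (num_messages n r1) (num_messages n r2),
    ((power1 N Q1 Q2 c <= P1%:E)%E /\ (power2 N Q1 Q2 c <= P2%:E)%E) /\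
    forall j, (j <= n)%N -> ok n j -> (error_prob N Q1 Q2 c <= (j.+1%:R^-1)%:E)%E.
  pose Pj : pred nat := fun j => (j <= n)%N && `[< ok n j >].
  have [ex|nex] := pselect (exists j, Pj j).
    have bd j : Pj j -> (j <= n)%N by case/andP.
    case: (ex_maxnP ex bd) => j /andP[jn /asboolP[c [ce c1 c2]]] jmax.
    exists c; split=> // i il oki.
    have ij : (i <= j)%N by apply: jmax; rewrite /Pj il; exact/asboolP.
    by apply: (le_trans ce); rewrite lee_fin lef_pV2 ?posrE// ler_nat.
  exists (zero_code n (Ordinal (num_messages_gt0 n r1), Ordinal (num_messages_gt0 n r2))).
  have z0 : sqnorm ([tuple 0 | i < n] : n.-tuple R) = 0.
    by rewrite /sqnorm big1// => i _; rewrite tnth_mktuple expr0n.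
  split; last by move=> j jn okj; exfalso; apply: nex; exists j; rewrite /Pj jn; exact/asboolP.
  split.
    rewrite /power1 big1 ?mule0 ?lee_fin// => w _.
    by rewrite /input1 /= z0 integral0.
  rewrite /power2 big1 ?mule0 ?lee_fin// => w _.
  by rewrite /input2 /= z0 integral0.
pose c n := sval (cid (sel n)); have hc n := svalP (cid (sel n)); rewrite -/(c _) in hc.
exists c; split; first by move=> n _; exact: (hc n).1.
have E0 n : (0 <= error_prob N Q1 Q2 (c n))%E.
  rewrite /error_prob mule_ge0 ?lee_fin//; apply: sume_ge0 => w _; exact: measure_ge0.
have small (e : R) : 0 < e -> \forall n \near \oo, (error_prob N Q1 Q2 (c n) <= e%:E)%E.
  move=> e0; pose j := Num.truncn e^-1.
  have je : j.+1%:R^-1 <= e by rewrite -[leRHS]invrK lef_pV2 ?posrE ?invr_gt0// ltW// truncnS_gt.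
  have j0 : 0 < (j.+1%:R^-1 : R) by rewrite invr_gt0.
  have [n0 hn0] := H _ j0.
  exists (maxn j n0) => // n /=; rewrite geq_max => /andP[jn n0n].
  apply: (@le_trans _ _ (j.+1%:R^-1)%:E); last by rewrite lee_fin.
  by apply: (hc n).2 => //; exact: hn0.
apply/fine_cvgP; split.
  near=> n; rewrite ge0_fin_numE//.
  apply: (@le_lt_trans _ _ 1%:E); last exact: ltry.
  by near: n; exact: small.
apply/cvgr0Pnorm_le => e e0; near=> n.
rewrite /= ger0_norm ?fine_ge0// -lee_fin fineK; first by near: n; exact: small.
rewrite ge0_fin_numE//; apply: (@le_lt_trans _ _ 1%:E); last exact: ltry.
by near: n; exact: small.
Unshelve. all: end_near. Qed.

End attained.

(** * Choice of parameters and passage to the closure *)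

Section assembly.
Context {R : realType}.

(** Half of the gap between [X = lam ^+ 2 * sg] and [P] is kept as power slack. The other half, [D],
    is shared: [D / 4] for [dl], [D / 4] for the two factors [1 + eta], and [D / 2] for the rounding
    constants [Cc], which are measured in grid steps and so shrink like [a ^+ 2]. *)
Lemma lattice_params (P sg lam : R) : 0 < sg -> 0 < lam -> lam ^+ 2 * sg < P ->
  exists P' a eta dl : R, [/\ [/\ 0 < P', P' < P, 0 < a, 0 < eta & 0 < dl] &
  (1 + eta) * (lam ^+ 2 * ((1 + eta) * ((sg + dl) / a ^+ 2) + (1 + eta^-1) * 2 ^+ 2))
    + (1 + eta^-1) * (lam + 1) ^+ 2 <= P' / a ^+ 2].
Proof.
move=> s0 l0; set X := lam ^+ 2 * sg => XP.
have X0 : 0 < X by rewrite mulr_gt0 ?exprn_gt0.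
have [D DE] : exists D, D = (P - X) / 2 by exists ((P - X) / 2).
have [P' P'E] : exists P', P' = X + D by exists (X + D).
have D0 : 0 < D by rewrite DE; clear -XP; lra.
have P'0 : 0 < P' by rewrite P'E addr_gt0.
pose eta := D / (12 * P').
have eta0 : 0 < eta by rewrite /eta divr_gt0 ?mulr_gt0.
have eta1 : eta <= 1.
  by rewrite /eta ler_pdivrMr ?mulr_gt0// mul1r P'E; clear -X0 D0; lra.
pose dl := D / (4 * lam ^+ 2).
have l20 : 0 < lam ^+ 2 by rewrite exprn_gt0.
have dl0 : 0 < dl by rewrite /dl divr_gt0 ?mulr_gt0.
pose Cc := (1 + eta) * (lam ^+ 2 * ((1 + eta^-1) * 2 ^+ 2)) + (1 + eta^-1) * (lam + 1) ^+ 2.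
have ei0 : 0 < 1 + eta^-1 by rewrite addr_gt0 ?invr_gt0.
have e10 : 0 < 1 + eta by rewrite addr_gt0.
have C0 : 0 < Cc.
  by rewrite /Cc addr_gt0// !mulr_gt0 ?exprn_gt0// addr_gt0.
pose a := Num.sqrt (D / (2 * Cc)).
have a0 : 0 < a by rewrite /a sqrtr_gt0 divr_gt0 ?mulr_gt0.
have a2 : a ^+ 2 = D / (2 * Cc) by rewrite /a sqr_sqrtr// ltW// divr_gt0 ?mulr_gt0.
exists P', a, eta, dl; split; first by split=> //; rewrite P'E DE; clear -XP; lra.
rewrite ler_pdivlMr ?exprn_gt0//.
have -> : ((1 + eta) * (lam ^+ 2 * ((1 + eta) * ((sg + dl) / a ^+ 2) + (1 + eta^-1) * 2 ^+ 2))
    + (1 + eta^-1) * (lam + 1) ^+ 2) * a ^+ 2 =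
  (1 + eta) ^+ 2 * (lam ^+ 2 * (sg + dl)) + Cc * a ^+ 2.
  by rewrite /Cc; field; rewrite !gt_eqF.
have -> : Cc * a ^+ 2 = D / 2 by rewrite a2; field; rewrite gt_eqF.
have -> : lam ^+ 2 * (sg + dl) = X + D / 4.
  by rewrite mulrDr -/X /dl; congr (_ + _); field; rewrite gt_eqF.
have e2 : (1 + eta) ^+ 2 <= 1 + 3 * eta by clear -eta0 eta1; nra.
have XD : 0 <= X + D / 4 by clear -X0 D0; lra.
have := ler_wpM2r XD e2.
have : eta * (12 * P') = D by rewrite divfK// gt_eqF// mulr_gt0.
rewrite P'E => h1 h2; apply: (le_trans (lerD h2 (lexx _))).
have h3 : 0 <= eta * D by rewrite mulr_ge0// ltW.
by clear -h1 h3; lra.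
Qed.

Lemma rational_between (x y : R) : 0 <= x -> x < y ->
  exists m k : nat, [/\ (0 < m)%N, (0 < k)%N, x < m%:R / k%:R & m%:R / k%:R < y].
Proof.
move=> x0 /rat_in_itvoo[q]; rewrite in_itv /= => /andP[xq qy].
have q0 : 0 < q by rewrite -(ltr0q R) (le_lt_trans x0).
have n0 : 0 < numq q by rewrite numq_gt0.
exists `|numq q|%N, `|denq q|%N.
have -> : (`|numq q|%N)%:R / (`|denq q|%N)%:R = ratr q :> R.
  by rewrite /ratr !natr_absz !gtr0_norm.
by split=> //; rewrite absz_gt0 ?denq_neq0// gt_eqF.
Qed.

(** The users enter symmetrically: the hypotheses on [be1] and [be2] say that one user has self
    noise coefficient 0 and the other [1 - al] up to sign, whichever is the weaker. *)
Lemma attained_core (P1 P2 N E1 E2 P al be1 be2 : R) (Q1 Q2 : probability (R * R)%type R) (r1 r2 : R) :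
  0 < N -> 0 <= E1 -> 0 <= E2 ->
  ('E_Q1[fun s => ((s.1 - s.2) ^+ 2)%R] = E1%:E)%E ->
  ('E_Q2[fun s => ((s.1 - s.2) ^+ 2)%R] = E2%:E)%E ->
  0 < P -> al = P / (P + (E1 + E2 + N)) ->
  (al * be1 - 1) * (al * be2 - 1) = 0 ->
  (al * be1 - 1) ^+ 2 + (al * be2 - 1) ^+ 2 = (1 - al) ^+ 2 ->
  0 < be1 -> 0 < be2 -> be1 ^+ 2 * P <= P1 -> be2 ^+ 2 * P <= P2 ->
  0 <= r1 -> 0 <= r2 -> r1 + r2 < 1 / 2 * log2 (1 + P / (E1 + E2 + N)) ->
  attained_rates P1 P2 N Q1 Q2 (r1, r2).
Proof.
move=> N0 E10 E20 hQ1 hQ2 P0 alE hc hs be10 be20 hP1 hP2 r10 r20 hr.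
set K := E1 + E2 + N in alE hr.
have K0 : 0 < K by rewrite ltr_wpDl// addr_ge0.
have PK : 0 < P + K by rewrite addr_gt0.
have al0 : 0 < al by rewrite alE divr_gt0.
have ln20 : 0 < ln (2 : R) by rewrite ln_gt0// ltr1n.
have hi0 : 0 < 1 + P / K by rewrite addr_gt0// divr_gt0.
have lohi : expR ((r1 + r2) * ln 2) < Num.sqrt (1 + P / K).
  rewrite -(ltr_pXn2r (_ : (0 < 2)%N)) ?nnegrE ?expR_ge0 ?sqrtr_ge0//.
  rewrite sqr_sqrtr ?(ltW hi0)// -expRM_natl -[ltRHS]lnK ?posrE// ltr_expR.
  have hr' := hr; rewrite /log2 mulrA ltr_pdivlMr// in hr'.
  by clear -hr'; lra.
(* The ratio of radii must be rational for the comparison of balls. It lies above the exponential of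
   the rate in nats, which leaves room for the codebooks, and below [Num.sqrt (1 + P / K)], which
   leaves room for the noise. *)
have [m [k [m0 k0 lo hi]]] := rational_between (expR_ge0 _) lohi.
set lam := m%:R / k%:R in lo hi.
have lam0 : 0 < lam by rewrite divr_gt0 ?ltr0n.
have sgE : (1 - al) ^+ 2 * P + al ^+ 2 * K = P * K / (P + K).
  by rewrite alE; field; rewrite gt_eqF.
have sg0 : 0 < P * K / (P + K) by rewrite divr_gt0// mulr_gt0.
have lamP : lam ^+ 2 * (P * K / (P + K)) < P.
  have : lam ^+ 2 < 1 + P / K.
    by rewrite -[ltRHS]sqr_sqrtr ?(ltW hi0)// ltr_pXn2r ?nnegrE ?sqrtr_ge0// ltW.
  rewrite -(@ltr_pM2r _ (P * K / (P + K)))// => h; apply: (lt_le_trans h).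
  by rewrite le_eqVlt; apply/orP; left; apply/eqP; field; rewrite !gt_eqF.
have [P' [a [eta [dl [[P'0 P'P a0 eta0 dl0] hpar]]]]] := lattice_params sg0 lam0 lamP.
pose gam := al / a.
have a20 : 0 < a ^+ 2 by rewrite exprn_gt0.
have mdiff : measurable_fun setT (fun t : R * R => t.1 - t.2) by exact: measurable_funB.
have [m1 [K1 [K1E C1]]] : exists m K, K <= gam ^+ 2 * E1 /\ centered Q1 (fun t => gam * (t.1 - t.2 - m)) K.
  by apply: centered_exists => //; move: hQ1; rewrite unlock => ->.
have [m2 [K2 [K2E C2]]] : exists m K, K <= gam ^+ 2 * E2 /\ centered Q2 (fun t => gam * (t.1 - t.2 - m)) K.
  by apply: centered_exists => //; move: hQ2; rewrite unlock => ->.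
have [m3 [K3 [K3E C3]]] : exists m K, K <= gam ^+ 2 * N /\ centered (noise_law N) (fun t => gam * (t - m)) K.
  by apply: (@centered_exists R _ _ (noise_law N) id N gam) => //; exact: noise_second_moment.
have gab be : gam * (a * be) = al * be by rewrite /gam mulrA divfK// gt_eqF.
have aB be : (a * be) ^+ 2 * (P' / a ^+ 2) = be ^+ 2 * P'.
  by rewrite exprMn; field; rewrite gt_eqF.
pose t2 := (1 + eta) * ((P * K / (P + K) + dl) / a ^+ 2) + (1 + eta^-1) * 2 ^+ 2.
have ln_lam : (r1 + r2) * ln 2 < ln lam.
  by rewrite -[ltLHS]expRK ltr_ln ?posrE ?expR_gt0.
apply: attained_of_eventually => //.
- by apply: le_trans hP1; rewrite mulr_ge0 ?sqr_ge0// ltW.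
- by apply: le_trans hP2; rewrite mulr_ge0 ?sqr_ge0// ltW.
apply: (@codes_exist_eventually R P1 P2 N Q1 Q2 gam (a * be1) (a * be2) (P' / a ^+ 2) t2 eta
  (dl / a ^+ 2) m1 m2 m3 K1 K2 K3 m k r1 r2) => //.
- by rewrite divr_gt0.
- by rewrite divr_gt0.
- by rewrite !gab.
- rewrite !gab hs /t2 lerD2r ler_pM2l ?addr_gt0// -sgE.
  have gK : gam ^+ 2 = al ^+ 2 / a ^+ 2 by rewrite /gam expr_div_n.
  have h1 : (1 - al) ^+ 2 * (P' / a ^+ 2) <= (1 - al) ^+ 2 * (P / a ^+ 2).
    by rewrite ler_wpM2l ?sqr_ge0// ler_pM2r ?invr_gt0// ltW.
  rewrite gK in K1E K2E K3E; rewrite /K !mulrDl mulrDr mulrDr.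
  by rewrite !mulrDl; clear -h1 K1E K2E K3E; lra.
- rewrite aB; apply: lt_le_trans hP1; rewrite ltr_pM2l ?exprn_gt0//.
- rewrite aB; apply: lt_le_trans hP2; rewrite ltr_pM2l ?exprn_gt0//.
Qed.

(** The pairs [((1 - e) * R1, (1 - e) * R2)] have sum strictly below [C], also when [R1 + R2] is 0
    because [C] is positive, and tend to [(R1, R2)]. *)
Lemma achievable_of_attained (P1 P2 N : R) (Q1 Q2 : probability (R * R)%type R) (R1 R2 C : R) :
  0 <= R1 -> 0 <= R2 -> 0 < C -> R1 + R2 <= C ->
  (forall r1 r2, 0 <= r1 -> 0 <= r2 -> r1 + r2 < C -> attained_rates P1 P2 N Q1 Q2 (r1, r2)) ->
  achievable P1 P2 N Q1 Q2 (R1, R2).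
Proof.
move=> R10 R20 C0 RC H B nB.
have cv1 (c : R) : (1 - e) * c @[e --> (0 : R)^'+] --> c.
  apply: cvg_at_right_filter.
  have H1 : (1 - e) * c @[e --> (0 : R)] --> (1 - 0) * c.
    apply: (@cvgM R); last exact: cvg_cst.
    by apply: (@cvgB _ R^o); [exact: cvg_cst|exact: cvg_id].
  by rewrite subr0 mul1r in H1.
have cv : ((1 - e) * R1, (1 - e) * R2) @[e --> (0 : R)^'+] --> (R1, R2).
  exact: cvg_pair (cv1 R1) (cv1 R2).
have nE : \forall e \near (0 : R)^'+, B ((1 - e) * R1, (1 - e) * R2) by exact: cv.
have [e [Be e0 e1]] : exists e : R, [/\ B ((1 - e) * R1, (1 - e) * R2), 0 < e & e < 1].
  suff : \forall e \near (0 : R)^'+, [/\ B ((1 - e) * R1, (1 - e) * R2), 0 < e & e < 1].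
    by move=> /filter_ex.
  near=> e; split.
  - by near: e.
  - by near: e; exact: nbhs_right_gt.
  - by near: e; exact: nbhs_right_lt.
exists ((1 - e) * R1, (1 - e) * R2); split=> //.
have e2 : 0 < 1 - e by rewrite subr_gt0.
apply: H; rewrite ?mulr_ge0 ?(ltW e2)// -mulrDr.
apply: (@le_lt_trans _ _ ((1 - e) * C)); first by rewrite ler_pM2l.
by rewrite gtr_pMl// gtrBl.
Unshelve. all: end_near. Qed.

End assembly.

Theorem theorem1 (R : realType) (P1 P2 N E1 E2 : R)
    (Q1 Q2 : probability (R * R)%type R)
    (hP1 : 0 < P1) (hP2 : 0 < P2) (hN : 0 < N)
    (hE1 : 0 <= E1) (hE2 : 0 <= E2)
    (hQ1 : ('E_Q1[fun s => ((s.1 - s.2) ^+ 2)%R] = E1%:E)%E)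
    (hQ2 : ('E_Q2[fun s => ((s.1 - s.2) ^+ 2)%R] = E2%:E)%E)
    (hP : P1 <> P2)
    (himb : E1 + E2 + N <= Num.sqrt (P1 * P2) - Num.min P1 P2)
    (R1 R2 : R) (hR1 : 0 <= R1) (hR2 : 0 <= R2)
    (hR : R1 + R2 <= 1 / 2 * log2 (1 + Num.min P1 P2 / (E1 + E2 + N))) :
  achievable P1 P2 N Q1 Q2 (R1, R2).
Proof.
set K := E1 + E2 + N in himb hR.
have K0 : 0 < K by rewrite ltr_wpDl// addr_ge0.
set P := Num.min P1 P2 in himb hR.
have P0 : 0 < P by rewrite lt_min hP1.
pose al := P / (P + K).
have PK : 0 < P + K by rewrite addr_gt0.
have al0 : 0 < al by rewrite divr_gt0.
(* Here [al^-1 * P = P + K], and the imbalance bounds it by [Num.sqrt (P1 * P2)]. Cancelling one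
   factor [P] leaves the larger power on the right, which is the power constraint of the stronger
   user. *)
have gain : (al^-1) ^+ 2 * P ^+ 2 <= P1 * P2.
  rewrite -exprMn /al invf_div divfK ?gt_eqF// -[leRHS]sqr_sqrtr ?mulr_ge0 ?(ltW hP1) ?(ltW hP2)//.
  by rewrite lerXn2r ?nnegrE ?sqrtr_ge0 ?(ltW PK)//; move: himb; lra.
have C0 : 0 < 1 / 2 * log2 (1 + P / K).
  rewrite mulr_gt0// /log2 divr_gt0// ln_gt0 ?ltr1n//.
  by rewrite ltrDl divr_gt0.
apply: (achievable_of_attained hR1 hR2 C0 hR) => r1 r2 r10 r20 hr.
have ala : al * al^-1 - 1 = 0 by rewrite divff ?subrr// gt_eqF.
have ai0 : 0 < al^-1 by rewrite invr_gt0.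
have [P12|P21] := leP P1 P2.
  have PE : P = P1 by rewrite /P min_l.
  apply: (@attained_core R P1 P2 N E1 E2 P al 1 al^-1) => //.
  - by rewrite ala mulr0.
  - by rewrite ala expr0n addr0 mulr1 -sqrrN opprB.
  - by rewrite expr1n mul1r PE.
  - by rewrite -(ler_pM2l P0); move: gain; rewrite -PE; clear; lra.
have PE : P = P2 by rewrite /P min_r// ltW.
apply: (@attained_core R P1 P2 N E1 E2 P al al^-1 1) => //.
- by rewrite ala mul0r.
- by rewrite ala expr0n add0r mulr1 -sqrrN opprB.
- by rewrite -(ler_pM2r P0); move: gain; rewrite -PE; clear; lra.
- by rewrite expr1n mul1r PE.
Qed.
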